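(* There is an algorithm that, given as input the set of cocircuits (as sign vectors in $\{-,0,+\}^k$) of an oriented matroid with ground set $\{1,\dots,k\}$, computes the Hasse diagram of the (big) face lattice of the oriented matroid in time $$O(n^2\cdot k\cdot\varphi),$$ where $n$ is the number of cocircuits and $\varphi$ is the total number of covectors of the oriented matroid. The algorithm requires $O(\varphi\cdot k)$ working space.
   Context: For $v,w\in\{-,0,+\}^k$, the separation set of $v$ and $w$ is the set of all indices $i$ such that one of $v_i,w_i$ is $+$ and the other one is $-$. The composition $v\circ w$ is defined by $(v\circ w)_i:=v_i$ if $v_i\ne 0$ and $(v\circ w)_i:=w_i$ otherwise. An oriented matroid with ground set $\{1,\dots,k\}$ is given by its set of covectors, a set $\mathcal{V}\subseteq\{-,0,+\}^k$ satisfying the usual covector axioms: the zero vector is in $\mathcal{V}$; $v\in\mathcal{V}$ implies $-v\in\mathcal{V}$; $v,w\in\mathcal{V}$ implies $v\circ w\in\mathcal{V}$; and for $v,w\in\mathcal{V}$ and any $e$ in the separation set of $v$ and $w$ there is $z\in\mathcal{V}$ with $z_e=0$ and $z_i=(v\circ w)_i=(w\circ v)_i$ for all $i$ not in the separation set. The partial order $\preceq$ on $\{-,0,+\}^k$ is defined by: $v\preceq w$ if and only if for all $i$ we have $v_i=0$ or $v_i=w_i$. The cocircuits of the oriented matroid are the $\preceq$-minimal elements among its nonzero covectors. The (big) face lattice is the poset of all covectors ordered by $\preceq$, with an artificial maximal element $\hat 1$ adjoined. Its Hasse diagram is the directed graph whose nodes correspond to the elements of the lattice and whose arcs correspond to the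 covering relations. Running times refer to the uniform time measure (every arithmetic operation or comparison takes one unit of time); memory requirements refer to the bit model (number of bits), and working space does not include the space for the output. The constants in the $O$-notation are absolute, and $O(f)$ means at most a constant times $\max\{1,f\}$. *)

(* Defs.v *)
From HB Require Import structures.
From mathcomp Require Import all_boot.

Set Implicit Arguments.
Unset Strict Implicit.
Unset Printing Implicit Defensive.

Inductive sign := Neg | Zero | Pos.

Definition sign_opp (a : sign) : sign :=
  match a with Neg => Pos | Zero => Zero | Pos => Neg end.

Definition option_of_sign (a : sign) : option bool :=
  match a with Neg => Some false | Zero => None | Pos => Some true end.

Definition sign_of_option (a : option bool) : sign :=
  match a with Some false => Neg | None => Zero | Some true => Pos end.

Lemma option_of_signK : cancel option_of_sign sign_of_option.
Proof. by case. Qed.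

HB.instance Definition _ := Finite.copy sign (can_type option_of_signK).

(** The index [i : 'I_k] stands for the ground set element [i + 1]. *)
Definition signvec (k : nat) := {ffun 'I_k -> sign}.

Section SignVectors.
Variable k : nat.
Implicit Types (v w z : signvec k) (V : {set signvec k}).

Definition sv0 : signvec k := [ffun=> Zero].

Definition sv_opp v : signvec k := [ffun i => sign_opp (v i)].

Definition sv_comp v w : signvec k :=
  [ffun i => if v i != Zero then v i else w i].

Definition sep v w : {set 'I_k} :=
  [set i | ((v i == Pos) && (w i == Neg)) || ((v i == Neg) && (w i == Pos))].

Definition sv_le v w : bool := [forall i, (v i == Zero) || (v i == w i)].

Record is_oriented_matroid V : Prop := IsOrientedMatroid {
  om_zero : sv0 \in V;
  om_opp : forall v, v \in V -> sv_opp v \in V;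
  om_comp : forall v w, v \in V -> w \in V -> sv_comp v w \in V;
  om_elim : forall v w e, v \in V -> w \in V -> e \in sep v w ->
    exists z, [/\ z \in V, z e = Zero &
      forall i, i \notin sep v w ->
        z i = sv_comp v w i /\ z i = sv_comp w v i] }.

Definition cocircuits V : {set signvec k} :=
  [set v in V | (v != sv0) &&
     [forall w in V, (w != sv0) && sv_le w v ==> (w == v)]].

(** Elements of the big face lattice: [Some v] is a covector and [None] is the
    adjoined maximal element. *)
Definition face := option (signvec k).

Definition face_lattice V : {set face} := None |: [set Some v | v in V].

Definition face_le (x y : face) : bool :=
  match x, y with
  | _, None => true
  | Some v, Some w => sv_le v w
  | None, Some _ => false
  end.

Definition face_lt (x y : face) : bool := (x != y) && face_le x y.

Definition face_covered V (x y : face) : bool :=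
  [&& x \in face_lattice V, y \in face_lattice V, face_lt x y &
      ~~ [exists z in face_lattice V, face_lt x z && face_lt z y]].

End SignVectors.

(** Random access machine model: programs compute with natural numbers.
    They have a read-only input, a write-only output and a random access working
    memory, whose cells are addressed by natural numbers and initially contain
    0. *)

Inductive binop := Add | Sub | Mul | Div | Eq | Lt.

Inductive expr :=
  | Const of nat
  | Read of expr
  | Input of expr
  | Bin of binop & expr & expr.

Inductive com :=
  | Skip
  | Store of expr & expr       (* [Store a e] puts the value of e in cell a *)
  | Output of expr
  | Seq of com & com
  | If of expr & com & com
  | While of expr & com.

(** Subtraction is truncated, division by 0 gives 0, and comparisons return 0
    or 1; in tests, every nonzero number counts as true. *)
Definition eval_binop (o : binop) (x y : nat) : nat :=
  match o with
  | Add => x + y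
  | Sub => x - y
  | Mul => x * y
  | Div => x %/ y
  | Eq => (x == y)
  | Lt => (x < y)
  end.

(** The memory is the list of the contents of cells 0, 1, ..., up to the
    largest address stored to so far. *)
Fixpoint eval (inp mem : seq nat) (e : expr) : nat :=
  match e with
  | Const c => c
  | Read a => nth 0 mem (eval inp mem a)
  | Input a => nth 0 inp (eval inp mem a)
  | Bin o e1 e2 => eval_binop o (eval inp mem e1) (eval inp mem e2)
  end.

(** Uniform time measure: each constant, memory or input access, arithmetic
    operation and comparison takes one unit. *)
Fixpoint cost (e : expr) : nat :=
  match e with
  | Const _ => 1
  | Read a => (cost a).+1
  | Input a => (cost a).+1
  | Bin _ e1 e2 => (cost e1 + cost e2).+1
  end.

(** Number of binary digits, with one digit for 0. *)
Definition bitlen (x : nat) : nat := (trunc_log 2 x).+1.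

(** Bit model.  Every cell below the largest address used is charged at least
    one bit, so that no information can be hidden for free in the choice of
    addresses. *)
Definition space (mem : seq nat) : nat := \sum_(x <- mem) bitlen x.

(** [exec inp c mem out t b mem' out']: on input [inp], started with memory
    [mem] and output [out], the program [c] stops after [t] units of time with
    memory [mem'] and output [out'], and the largest amount of memory in use at
    any moment is [b] bits.  Input and output are not charged.  Neither are
    intermediate values of expressions: the expressions of a fixed program have
    bounded size, so this affects the space by a constant factor only. *)
Inductive exec (inp : seq nat) :
    com -> seq nat -> seq nat -> nat -> nat -> seq nat -> seq nat -> Prop :=
  | ExecSkip mem out :
      exec inp Skip mem out 1 (space mem) mem out
  | ExecStore a e mem out mem' :
      mem' = set_nth 0 mem (eval inp mem a) (eval inp mem e) ->
      exec inp (Store a e) mem out (cost a + cost e).+1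
        (maxn (space mem) (space mem')) mem' out
  | ExecOutput e mem out :
      exec inp (Output e) mem out (cost e).+1 (space mem)
        mem (rcons out (eval inp mem e))
  | ExecSeq c1 c2 mem out t1 b1 mem1 out1 t2 b2 mem2 out2 :
      exec inp c1 mem out t1 b1 mem1 out1 ->
      exec inp c2 mem1 out1 t2 b2 mem2 out2 ->
      exec inp (Seq c1 c2) mem out (t1 + t2) (maxn b1 b2) mem2 out2
  | ExecIf e c1 c2 mem out t b mem' out' :
      exec inp (if eval inp mem e != 0 then c1 else c2) mem out t b mem' out' ->
      exec inp (If e c1 c2) mem out (cost e + t).+1 b mem' out'
  | ExecWhileEnd e c mem out :
      eval inp mem e = 0 ->
      exec inp (While e c) mem out (cost e).+1 (space mem) mem out
  | ExecWhileStep e c mem out t1 b1 mem1 out1 t2 b2 mem2 out2 :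
      eval inp mem e <> 0 ->
      exec inp c mem out t1 b1 mem1 out1 ->
      exec inp (While e c) mem1 out1 t2 b2 mem2 out2 ->
      exec inp (While e c) mem out (cost e + t1 + t2).+1 (maxn b1 b2) mem2 out2.

Definition sign_code (a : sign) : nat :=
  match a with Zero => 0 | Pos => 1 | Neg => 2 end.

Definition sv_code k (v : signvec k) : seq nat :=
  [seq sign_code (v i) | i <- enum 'I_k].

Definition input_code k (s : seq (signvec k)) : seq nat :=
  [:: k, size s & flatten [seq sv_code v | v <- s]].

(** The output is a sequence of records.  A node record names an element of the
    lattice; nodes are numbered 0, 1, 2, ... in the order of their records.  An
    arc record [ArcRec i j] is an arc from node number [i] to node number [j]
    (either of which may be recorded later).  Node and arc records may be
    interleaved. *)
Inductive record (k : nat) :=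
  | NodeRec of face k
  | ArcRec of nat & nat.
Arguments ArcRec {k} _ _.

(** The zero covector has a code of constant length because an oriented matroid
    without cocircuits must be processed in time O(1), whatever [k] is. *)
Definition record_code k (r : record k) : seq nat :=
  match r with
  | NodeRec None => [:: 0]
  | NodeRec (Some v) => if v == sv0 k then [:: 1] else 2 :: sv_code v
  | ArcRec i j => [:: 3; i; j]
  end.

Definition rec_nodes k (rs : seq (record k)) : seq (face k) :=
  pmap (fun r => if r is NodeRec x then Some x else None) rs.

Definition rec_arcs k (rs : seq (record k)) : seq (nat * nat) :=
  pmap (fun r => if r is ArcRec i j then Some (i, j) else None) rs.

(** Every lattice element is listed exactly once, and so is every arc; arcs
    point from the smaller to the larger element of a covering pair. *)
Definition is_hasse_diagram k (V : {set signvec k})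
    (nodes : seq (face k)) (arcs : seq (nat * nat)) : Prop :=
  [/\ uniq nodes, nodes =i face_lattice V, uniq arcs &
      forall i j, ((i, j) \in arcs) =
        [&& i < size nodes, j < size nodes &
            face_covered V (nth None nodes i) (nth None nodes j)]].

Definition encodes_hasse_diagram k (V : {set signvec k}) (out : seq nat) :=
  exists rs : seq (record k),
    out = flatten [seq record_code r | r <- rs] /\
    is_hasse_diagram V (rec_nodes rs) (rec_arcs rs).

(* Main.v *)
(* Every covector is the composition of the cocircuits below it.  Hence all
   covectors are reached from 0 by steps from [v] to [v o c] with [c] a
   cocircuit, and the covers of [v] are the minimal elements among the vectors
   [v o c] different from [v].  The covectors are generated in breadth-first
   order and kept in a digital search tree: a node of depth [d] branches on
   whether cocircuit number [d] is below the vector sought.  As a covector is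
   determined by the cocircuits below it, no path is longer than [n], so that a
   lookup takes time O(n k); there are [n] lookups and [n] tests for minimality,
   each O(n k), per covector.  A covector is stored as [k] signs and two
   pointers, which have O(k) bits since there are at most [3 ^ k] covectors.
   The adjoined maximum is output as node 0 and covector number [x] as node
   [x + 1]. *)
Require Import Defs.
From mathcomp Require Import all_boot.
From mathcomp Require Import zify.

Set Implicit Arguments.
Unset Strict Implicit.
Unset Printing Implicit Defensive.

(** * Covectors and cocircuits *)

(** Elimination enters at one point only: each nonzero coordinate of a covector is attained by a
    cocircuit below it. The generation of all covectors, the description of the covers and the
    injectivity of the search keys all follow from this. The time bound has no additive term in [k]:
    without cocircuits, 0 is the only covector and the time must be constant. So every pass over the
    ground set happens inside the loop over the cocircuits, and the zero covector is never written;
    the initial memory already holds it, as [Zero] has code 0. With a cocircuit, both [n] and [k]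
    are positive and absorb the lower-order terms. Candidates for covers are not stored: minimality
    is decided by scanning the cocircuits again, and arcs go to the output at once. Several
    cocircuits may give the same composition, hence a tie-break by index. Arcs appear while the list
    of covectors still grows; their numbers stay valid because the list is only extended at its
    end. *)

Section Covectors.
Variable k : nat.
Implicit Types (u v w y z c : signvec k) (V : {set signvec k}).

Lemma sv_leP v w : reflect (forall i, v i = Zero \/ v i = w i) (sv_le v w).
Proof.
apply: (iffP forallP) => H i; last by case: (H i) => ->; rewrite eqxx ?orbT.
by case/orP: (H i) => /eqP; [left|right].
Qed.

Lemma sv_le_refl v : sv_le v v.
Proof. by apply/sv_leP=> i; right. Qed.

Lemma sv_le_trans v u w : sv_le u v -> sv_le v w -> sv_le u w.
Proof.
move=> /sv_leP uv /sv_leP vw; apply/sv_leP=> i.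
by case: (uv i) => [->|->]; [left|apply: vw].
Qed.

Lemma sv_le_anti u v : sv_le u v -> sv_le v u -> u = v.
Proof.
move=> /sv_leP uv /sv_leP vu; apply/ffunP=> i.
by case: (uv i) => // ui; case: (vu i) => // vi; rewrite ui vi.
Qed.

Lemma sv_le_comp v w : sv_le v (sv_comp v w).
Proof. by apply/sv_leP=> i; rewrite ffunE; case: eqP; [left|right]. Qed.

Lemma sv_comp_le u v w : sv_le u w -> sv_le v w -> sv_le (sv_comp u v) w.
Proof.
move=> /sv_leP uw /sv_leP vw; apply/sv_leP=> i; rewrite ffunE.
by case: ifP => // _; apply: uw.
Qed.

Definition supp v : {set 'I_k} := [set i | v i != Zero].

Lemma supp_lt u v : sv_le u v -> u != v -> #|supp u| < #|supp v|.
Proof.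
move=> /sv_leP uv nuv; apply: proper_card; apply/properP; split.
  by apply/subsetP=> i; rewrite !inE; case: (uv i) => ->.
have [i ni] : exists i, u i != v i.
  by apply/existsP; apply: contraNT nuv => /existsPn H; apply/eqP/ffunP=> i; have /negPn/eqP := H i.
by exists i; rewrite !inE; case: (uv i) ni => ->; rewrite ?eqxx // eq_sym.
Qed.

Section OrientedMatroid.
Variable V : {set signvec k}.
Hypothesis omV : is_oriented_matroid V.

(* Repeated elimination between [z] and [y] removes their separation set
   while keeping the coordinate [i]. *)
Lemma conformal_below z y i :
    z \in V -> y \in V -> supp y \subset supp z -> y i = z i -> y != z ->
  exists y', [/\ y' \in V, sv_le y' z, y' != z & y' i = z i].
Proof.
move=> Vz; have [m] := ubnP #|sep y z|; elim: m y => // m IH y /ltnSE lem Vy sub yi nyz.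
have [s0|[e es]] := set_0Vmem (sep y z).
  exists y; split=> //; apply/sv_leP=> x; have := in_set0 x; rewrite -s0 inE.
  have /implyP := subsetP sub x; rewrite !inE.
  by case: (y x) (z x) => [] []; auto.
have es' : e \in sep z y by move: es; rewrite !inE; case: (y e) (z e) => [] [].
(* Off the separation set, [x] agrees with the composition of [z] and [y], so no new separation from
   [z] arises; [e] itself drops out because [x e = Zero], which also gives [x != z]. *)
have [x [Vx xe xP]] := om_elim omV Vz Vy es'.
have sepE f : (f \in sep z y) = (f \in sep y z).
  by rewrite !inE; case: (y f) (z f) => [] [].
apply: (IH x) => //.
- apply: leq_trans lem; apply: proper_card; apply/properP; split; last first.
    by exists e => //; rewrite !inE xe.
  apply/subsetP=> f; apply: contraTT => fs; have [|] := xP f; first by rewrite sepE.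
  by move: fs; rewrite !inE !ffunE => fs -> ; move: fs; case: (y f) (z f) => [] [].
- apply/subsetP=> f; have [fs _|fs] := boolP (f \in sep z y).
    by move: fs; rewrite !inE; case: (z f); rewrite ?andbF.
  have [] := xP f fs; rewrite !inE !ffunE => -> _.
  by have /implyP := subsetP sub f; rewrite !inE; case: (z f) (y f) => [] [].
- have [|->] := xP i; last by rewrite ffunE yi; case: (z i).
  by rewrite !inE yi; case: (z i).
- by apply: contraTneq es => <-; rewrite !inE xe !andbF.
Qed.

(** Induction on the support. If [z] is not a cocircuit, some nonzero covector [u] lies strictly
    below it; either [u] keeps the coordinate [i], or [u] vanishes there and serves to produce
    another covector below [z] that keeps it. *)
Lemma cocircuit_through z i :
  z \in V -> z i != Zero ->
  exists c, [/\ c \in cocircuits V, sv_le c z & c i = z i].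
Proof.
have [m] := ubnP #|supp z|; elim: m z => // m IH z /ltnSE lem Vz zi.
have z0 : z != sv0 k by apply: contraNneq zi => ->; rewrite ffunE.
have descend y : y \in V -> sv_le y z -> y != z -> y i = z i ->
    exists c, [/\ c \in cocircuits V, sv_le c z & c i = z i].
  move=> Vy yz nyz yi; have [] := IH y; rewrite ?yi //.
    exact: leq_trans (supp_lt yz nyz) lem.
  by move=> c [cV cy ci]; exists c; split=> //; apply: sv_le_trans cy yz.
have [zc|] := boolP (z \in cocircuits V).
  by exists z; split=> //; apply: sv_le_refl.
rewrite inE Vz z0 /= => /forall_inPn[u Vu]; rewrite negb_imply => /andP[/andP[u0 uz] nuz].
have /sv_leP uzi := uz.
case: (uzi i) => [ui|]; last exact: descend.
have [e ue] : exists e, u e != Zero.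
  by apply/existsP; apply: contraNT u0 => /existsPn H; apply/eqP/ffunP=> e;
    rewrite ffunE; have /negPn/eqP := H e.
(* The composition of [-u] and [z] is [z] with its signs reversed on the support of [u]: it differs
   from [z], has the same support and is unchanged at [i]. *)
have [||||y [Vy yz nyz yi]] := @conformal_below z (sv_comp (sv_opp u) z) i Vz.
- exact: (om_comp omV (om_opp omV Vu) Vz).
- apply/subsetP=> f; rewrite !inE !ffunE.
  by case: (uzi f) => ->; case: (z f).
- by rewrite !ffunE ui.
- apply/eqP => /ffunP/(_ e); rewrite !ffunE.
  by case: (uzi e) ue => ->; [rewrite eqxx|case: (z e)].
exact: descend yi.
Qed.

(** The progress step: below any larger covector [z], composing with a suitable cocircuit moves [v]
    upwards, and the result is still below [z]. *)
Lemma cocircuit_step v z :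
  z \in V -> sv_le v z -> v != z ->
  exists c, [/\ c \in cocircuits V, sv_le c z & sv_comp v c != v].
Proof.
move=> Vz /sv_leP vz nvz.
have [i ni] : exists i, v i != z i.
  apply/existsP; apply: contraNT nvz => /existsPn H; apply/eqP/ffunP=> i.
  by have /negPn/eqP := H i.
have vi : v i = Zero by case: (vz i) ni => // ->; rewrite eqxx.
have [|c [cV cz ci]] := cocircuit_through (i := i) Vz; first by rewrite -vi eq_sym.
exists c; split=> //; apply: contraNneq ni => /ffunP/(_ i).
by rewrite ffunE vi /= ci => ->.
Qed.

(** Each nonzero coordinate of [u] is attained by a cocircuit below [u], hence below [v], and vice
    versa. This makes the [n] comparisons with cocircuits a faithful search key. *)
Lemma cocircuits_below_inj u v :
  u \in V -> v \in V ->
  (forall c, c \in cocircuits V -> sv_le c u = sv_le c v) -> u = v.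
Proof.
have main x y : x \in V -> (forall c, c \in cocircuits V -> sv_le c x = sv_le c y) -> sv_le x y.
  move=> Vx H; apply/sv_leP=> i; have [->|xi] := eqVneq (x i) Zero; first by left.
  have [c [cV cx ci]] := cocircuit_through Vx xi; right.
  move: cx; rewrite H // => /sv_leP/(_ i)[|]; rewrite ci // => x0.
  by rewrite x0 eqxx in xi.
move=> Vu Vv H; apply: sv_le_anti; apply: main => // c cV.
by rewrite H.
Qed.

(** A covector strictly between [v] and [w] would have, by [cocircuit_step], some nontrivial
    [v o c'] below it. Conversely, under a cover [w] every nontrivial [v o c'] below [w] must equal
    [w]. *)
Lemma cocircuits_cover (s : seq (signvec k)) : s =i cocircuits V ->
  forall v w, v \in V -> w \in V ->
  face_covered V (Some v) (Some w) =
  has (fun c => [&& w == sv_comp v c, w != v &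
     all (fun c' => ~~ [&& sv_comp v c' != v, sv_le (sv_comp v c') w &
                           sv_comp v c' != w]) s]) s.
Proof.
move=> sV v w Vv Vw.
have inF z : z \in V -> Some z \in face_lattice V.
  by move=> Vz; rewrite !inE imset_f.
have compV c : c \in s -> sv_comp v c \in V.
  by rewrite sV inE => /andP[cV _]; apply: om_comp.
apply/idP/hasP.
  rewrite /face_covered /face_lt !inF //= => /andP[/andP[nvw vw] /exists_inPn H].
  have nvw' : v != w by apply: contraNneq nvw => ->.
  have [c [cV cw nc]] := cocircuit_step Vw vw nvw'.
  have none c' : c' \in s -> sv_comp v c' != v -> sv_le (sv_comp v c') w ->
      sv_comp v c' = w.
    move=> c's nc' lec'; apply/eqP; apply: contraT => nw.
    have := H _ (inF _ (compV _ c's)); rewrite /= sv_le_comp lec' !andbT.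
    by rewrite eq_sym (inj_eq Some_inj) nc' (inj_eq Some_inj) nw.
  exists c; rewrite ?sV //; apply/and3P; split; rewrite 1?eq_sym //.
    by apply/eqP/none; rewrite ?sV //; apply: sv_comp_le.
  apply/allP=> c' c's; apply/negP=> /and3P[nc' lec' /eqP]; apply.
  exact: none.
case=> c cs /and3P[/eqP wE nwv /allP H].
rewrite /face_covered /face_lt !inF //= eq_sym (inj_eq Some_inj) nwv.
have -> : sv_le v w by rewrite wE sv_le_comp.
apply/exists_inPn => -[z|] zV; last by rewrite andbF.
have {}zV : z \in V.
  by move: zV; rewrite !inE => /= /imsetP[y Vy [->]].
rewrite !(inj_eq Some_inj) /=; apply/negP => /andP[/andP[nvz vz] /andP[nzw zw]].
have [c' [c's c'z nc']] := cocircuit_step zV vz nvz.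
have le' : sv_le (sv_comp v c') z by apply: sv_comp_le.
have := H c'; rewrite sV c's nc' (sv_le_trans le' zw) /= => /(_ isT) /negPn/eqP E.
by rewrite E in le'; move/eqP: nzw; apply; apply: sv_le_anti.
Qed.

Lemma cocircuits_top (s : seq (signvec k)) : s =i cocircuits V ->
  forall v, v \in V ->
  face_covered V (Some v) None = all (fun c => sv_comp v c == v) s.
Proof.
move=> sV v Vv.
have compV c : c \in s -> sv_comp v c \in V.
  by rewrite sV inE => /andP[cV _]; apply: om_comp.
rewrite /face_covered /face_lt !inE imset_f //=.
apply/exists_inPn/allP => [H c cs|H [z|] //].
  have := H (Some (sv_comp v c)); rewrite ?inE imset_f ?compV //=.
  by rewrite sv_le_comp !andbT => /(_ isT) /negPn/eqP[{2}->].
rewrite !inE /= => /imsetP[y Vy [->]]; rewrite andbT (inj_eq Some_inj).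
apply/negP => /andP[nvy vy].
have [c [cs _]] := cocircuit_step Vy vy nvy.
by rewrite H ?sV.
Qed.

(** Climb from 0 to [z] by cocircuit steps that stay below [z]; the support grows with each step, so
    the climb ends at [z]. *)
Lemma closed_contains_all (s ks : seq (signvec k)) : s =i cocircuits V ->
  sv0 k \in ks ->
  (forall v c, v \in ks -> c \in s -> sv_comp v c \in ks) ->
  {subset V <= ks}.
Proof.
move=> sV k0 clos z Vz.
suff H m : forall v, v \in ks -> sv_le v z -> #|supp z| - #|supp v| < m -> z \in ks.
  apply: H k0 _ (leqnn _); apply/sv_leP=> i; left; exact: ffunE.
elim: m => // m IH v kv vz lem.
have [<- //|nvz] := eqVneq v z.
have [c [cV cz nc]] := cocircuit_step Vz vz nvz.
have cz' : sv_le (sv_comp v c) z by apply: sv_comp_le.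
apply: (IH (sv_comp v c)) => //; first by apply: clos; rewrite ?sV.
have := supp_lt vz nvz; have : #|supp v| < #|supp (sv_comp v c)|.
  by apply: supp_lt; rewrite 1?eq_sym ?sv_le_comp.
lia.
Qed.

(** The degenerate case of the time bound: then the loop over covectors runs once and its inner loop
    never. *)
Lemma no_cocircuits : #|cocircuits V| = 0 -> #|V| = 1.
Proof.
move=> c0; suff -> : V = [set sv0 k] by rewrite cards1.
apply/eqP; rewrite eqEsubset sub1set (om_zero omV) andbT; apply/subsetP => z Vz.
rewrite inE; apply: contraT => nz.
have z_ge0 : sv_le (sv0 k) z by apply/sv_leP=> i; left; exact: ffunE.
have [|c [cV _ _]] := cocircuit_step Vz z_ge0; first by rewrite eq_sym.
by move: cV; rewrite (cards0_eq c0) inE.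
Qed.

End OrientedMatroid.

Lemma card_covectors V : #|V| <= 3 ^ k.
Proof.
apply: leq_trans (max_card _) _.
rewrite card_ffun card_ord (@bij_eq_card _ _ option_of_sign) ?card_option ?card_bool //.
by exists sign_of_option; [exact: option_of_signK|case=> [[]|]].
Qed.

End Covectors.

(** * Digital search trees *)

Section SearchTree.
Variables (k : nat) (V : {set signvec k}) (s : seq (signvec k)).
Hypothesis omV : is_oriented_matroid V.
Hypothesis sV : s =i cocircuits V.
Implicit Types (w : signvec k) (ks : seq (signvec k)).

Local Notation key ks x := (nth (sv0 k) ks x).

(** The bits are negated because the program detects a coordinate that violates the order. *)
Definition bits w : seq bool := [seq ~~ sv_le c w | c <- s].

Lemma nth_bits w d : d < size s -> nth false (bits w) d = ~~ sv_le (nth (sv0 k) s d) w.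
Proof. by move=> ds; rewrite (nth_map (sv0 k)). Qed.

Lemma bits_inj : {in V &, injective bits}.
Proof.
move=> u w Vu Vw E; apply: (cocircuits_below_inj omV Vu Vw) => c.
rewrite -sV => cs; apply: negb_inj.
by move/eq_in_map: E => /(_ c cs).
Qed.

(** [path] is a ghost, the word of branchings from the root to a node; only keys and pointers are
    stored. The value 0 can serve as null pointer since the root is nobody's child. By [st_out] the
    pointers of the next free slot are null, so a new node needs no initialization. *)
Record search_tree ks (ptr : nat -> bool -> nat) (path : nat -> seq bool) : Prop :=
  SearchTree {
    st_root : path 0 = [::];
    st_prefix : forall x, x < size ks ->
      path x = take (size (path x)) (bits (key ks x));
    st_inj : forall x y, x < size ks -> y < size ks -> path x = path y -> x = y;
    st_child : forall x b, x < size ks -> ptr x b != 0 ->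
      ptr x b < size ks /\ path (ptr x b) = rcons (path x) b;
    st_anc : forall y d, y < size ks -> d < size (path y) ->
      exists x, [/\ x < size ks, path x = take d (path y) &
                    ptr x (nth false (path y) d) != 0];
    st_out : forall x b, size ks <= x -> ptr x b = 0 }.

Lemma search_tree1 ptr : (forall x b, ptr x b = 0) ->
  search_tree [:: sv0 k] ptr (fun=> [::]).
Proof.
move=> p0; split=> //.
- by move=> x _; rewrite take0.
- by move=> [|x] [|y].
- by move=> x b _; rewrite p0.
Qed.

Variables (ks : seq (signvec k)) (ptr : nat -> bool -> nat) (path : nat -> seq bool).
Hypothesis tree : search_tree ks ptr path.
Hypothesis ksV : {subset ks <= V}.
Variable w : signvec k.
Hypothesis Vw : w \in V.

(* The last clause says that [w] is not the key of a proper ancestor of [q]. *)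
Definition search_at q d : Prop :=
  [/\ q < size ks, d <= size s, path q = take d (bits w) &
      forall y, y < size ks -> key ks y = w -> d <= size (path y)].

Lemma search_at0 : 0 < size ks -> search_at 0 0.
Proof. by move=> ks0; split; rewrite // (st_root tree) take0. Qed.

Section Step.
Variables (q d : nat).
Hypothesis qd : search_at q d.
Hypothesis qw : key ks q != w.
Let b := ~~ sv_le (nth (sv0 k) s d) w.

Lemma size_path_at : size (path q) = d.
Proof. by case: qd => _ ds -> _; rewrite size_takel ?size_map. Qed.

(** At depth [size s] the path of [q] would be the whole bit string of [w], and by [bits_inj] the
    key of [q] would be [w]. This bounds the length of a search. *)
Lemma search_lt : d < size s.
Proof.
case: qd => qs ds pq _; rewrite ltn_neqAle ds andbT; apply: contraNneq qw => dE.
apply/eqP/(bits_inj (ksV (mem_nth _ qs)) Vw).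
have := st_prefix tree qs; rewrite size_path_at pq dE.
by rewrite !take_oversize ?size_map.
Qed.

Lemma path_rcons : take d.+1 (bits w) = rcons (path q) b.
Proof.
case: qd => _ _ -> _; rewrite (take_nth false) ?nth_bits ?size_map //; exact: search_lt.
Qed.

(** A node of depth exactly [d] with key [w] would have the same path as [q], hence be [q], whose
    key is not [w]. *)
Lemma key_below y : y < size ks -> key ks y = w -> d < size (path y).
Proof.
move=> ys yw; case: qd => qs _ pq /(_ y ys yw); rewrite leq_eqVlt => /predU1P[dE|//].
case/eqP: qw; rewrite -yw; congr nth; apply: (st_inj tree) => //.
by rewrite pq (st_prefix tree ys) yw -dE.
Qed.

(** The ancestor at depth [d] of a node with key [w] has the path of [q], hence is [q]; the branch
    from it towards that node is the one chosen by [w]. *)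
Lemma key_child y : y < size ks -> key ks y = w ->
  ptr q b != 0.
Proof.
move=> ys yw; have dy := key_below ys yw.
have [x [xs px]] := st_anc tree ys dy.
have py : path y = take (size (path y)) (bits w) by rewrite {1}(st_prefix tree ys) yw.
have -> : x = q.
  apply: (st_inj tree) => //; first by case: qd.
  by case: qd => _ _ -> _; rewrite px py take_takel // ltnW.
by rewrite py nth_take // nth_bits //; apply: search_lt.
Qed.

Lemma search_child : ptr q b != 0 -> search_at (ptr q b) d.+1.
Proof.
case: qd => qs ds pq _ pb; have [cs pc] := st_child tree qs pb.
split=> //; first exact: search_lt.
  by rewrite pc path_rcons.
exact: key_below.
Qed.

Hypothesis pb0 : ptr q b = 0.

Lemma search_notin : w \notin ks.
Proof.
apply/negP=> /(nthP (sv0 k))[y ys yw].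
by have := key_child ys yw; rewrite pb0.
Qed.

Lemma search_insert ptr' :
  (forall x c, ptr' x c = if (x == q) && (c == b) then size ks else ptr x c) ->
  search_tree (rcons ks w) ptr'
    (fun x => if x == size ks then rcons (path q) b else path x).
Proof.
move=> p'E; case: qd => qs ds pq _.
have ks_gt0 : 0 < size ks by apply: leq_trans qs.
have xne x : x < size ks -> (x == size ks) = false by move=> xs; apply: ltn_eqF.
(* A node with this path would, by [st_anc], force the pointer of [q] on branch [b] to be
   nonzero. *)
have fresh x : x < size ks -> path x <> rcons (path q) b.
  move=> xs px; have /(st_anc tree xs)[y [ys py]] : d < size (path x).
    by rewrite px size_rcons size_path_at.
  have -> : y = q.
    by apply: (st_inj tree) => //; rewrite py px -size_path_at -cats1 take_size_cat.
  by rewrite px nth_rcons size_path_at ltnn eqxx pb0.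
have leS x : x < size (rcons ks w) -> x = size ks \/ x < size ks.
  by rewrite size_rcons ltnS leq_eqVlt => /predU1P.
have keyE x : x < size ks -> key (rcons ks w) x = key ks x.
  by move=> xs; rewrite nth_rcons xs.
split.
- by rewrite xne // (st_root tree).
- move=> x /leS[->|xs].
    rewrite eqxx nth_rcons ltnn eqxx size_rcons size_path_at.
    exact/esym/path_rcons.
  by rewrite xne // keyE //; apply: (st_prefix tree).
- move=> x y /leS[->|xs] /leS[->|ys]; rewrite ?eqxx ?xne //.
  + by move=> E; case: (fresh y ys).
  + by move=> E; case: (fresh x xs).
  exact: (st_inj tree).
- move=> x c /leS[->|xs]; rewrite p'E.
    by rewrite [size ks == q]eq_sym (xne q qs) /= (st_out tree).
  case: (x =P q) => [->|_] /=; last first.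
    move=> /(st_child tree xs)[cs pc]; rewrite size_rcons ltnW ?ltnS //.
    by rewrite !xne.
  case: (c =P b) => [->|_] /=; first by rewrite size_rcons ltnSn eqxx xne.
  move=> /(st_child tree qs)[cs pc]; rewrite size_rcons ltnW ?ltnS //.
  by rewrite !xne.
- move=> y e /leS[->|ys].
    rewrite eqxx size_rcons ltnS leq_eqVlt => /predU1P[->|ed].
      exists q; rewrite xne // size_rcons ltnW ?ltnS // nth_rcons ltnn eqxx p'E !eqxx.
      by rewrite -cats1 take_size_cat // lt0n_neq0.
    have [x [xs px pp]] := st_anc tree qs ed.
    exists x; rewrite xne // size_rcons ltnW ?ltnS // nth_rcons ed p'E.
    rewrite -cats1 takel_cat ?(ltnW ed) //; split=> //.
    by case: ifP => // _; rewrite lt0n_neq0.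
  rewrite xne // => ed; have [x [xs px pp]] := st_anc tree ys ed.
  exists x; rewrite xne // size_rcons ltnW ?ltnS // p'E; split=> //.
  by case: ifP => // _; rewrite lt0n_neq0.
move=> x c; rewrite size_rcons p'E => xs.
have -> /= : (x == q) = false by lia.
by apply: (st_out tree); apply: ltnW.
Qed.

End Step.
End SearchTree.

(** * Bounds on running time and space of programs *)

Local Notation cell := (nth 0).

Lemma cell_set mem a v b :
  cell (set_nth 0 mem a v) b = if b == a then v else cell mem b.
Proof. by rewrite nth_set_nth. Qed.

Section ProgramLogic.
Variables (inp : seq nat) (msize : nat) (lim : nat -> nat).
Implicit Types (mem out : seq nat) (e a : expr) (c : com) (Q : seq nat -> seq nat -> Prop).

Definition bounded mem := size mem <= msize /\ forall i, cell mem i <= lim i.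

Definition space_limit := \sum_(i < msize) bitlen (lim i).

Lemma bitlen_leq x y : x <= y -> bitlen x <= bitlen y.
Proof. by move=> xy; rewrite ltnS; apply: leq_trunc_log. Qed.

Lemma space_bounded mem : bounded mem -> space mem <= space_limit.
Proof.
case=> sz le; rewrite /space (big_nth 0) /space_limit -(big_mkord predT (fun i => bitlen (lim i))).
rewrite [leqRHS](big_cat_nat (n := size mem)) //=.
apply: (leq_trans _ (leq_addr _ _)); apply: leq_sum => i _; apply/bitlen_leq/le.
Qed.

(** Total correctness with a time bound, from one concrete initial state, so that facts about it
    remain ordinary hypotheses. The space bound is the same for all programs; [bounded] is threaded
    through here and rechecked only at stores. *)
Definition run c mem out t Q :=
  bounded mem -> exists t' b mem' out',
    [/\ exec inp c mem out t' b mem' out', t' <= t, b <= space_limit,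
        bounded mem' & Q mem' out'].

Lemma run_weaken c mem out t t' Q Q' :
  run c mem out t Q -> t <= t' -> (forall m o, Q m o -> Q' m o) -> run c mem out t' Q'.
Proof.
move=> H tt' QQ' /H[t1 [b [m [o [ex t1t bB gm q]]]]].
exists t1, b, m, o; split=> //; [exact: leq_trans tt'|exact: QQ'].
Qed.

Lemma run_time c mem out t t' Q :
  run c mem out t Q -> t <= t' -> run c mem out t' Q.
Proof. by move=> H le; apply: run_weaken H le _. Qed.

Lemma run_skip mem out Q : Q mem out -> run Skip mem out 1 Q.
Proof.
by move=> q g; exists 1, (space mem), mem, out; split=> //; [constructor|apply: space_bounded].
Qed.

Lemma run_store a e mem out Q :
  eval inp mem a < msize -> eval inp mem e <= lim (eval inp mem a) ->
  Q (set_nth 0 mem (eval inp mem a) (eval inp mem e)) out ->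
  run (Store a e) mem out (cost a + cost e).+1 Q.
Proof.
move=> aS eL; set mem' := set_nth _ _ _ _ => q g.
have g' : bounded mem'.
  case: g => sz le; split=> [|i]; first by rewrite size_set_nth geq_max aS.
  by rewrite cell_set; case: eqP => [->|].
exists (cost a + cost e).+1, (maxn (space mem) (space mem')), mem', out; split=> //.
  by constructor.
by rewrite geq_max !space_bounded.
Qed.

Lemma run_output e mem out Q :
  Q mem (rcons out (eval inp mem e)) -> run (Output e) mem out (cost e).+1 Q.
Proof.
move=> q g; exists (cost e).+1, (space mem), mem, (rcons out (eval inp mem e)).
by split=> //; [constructor|apply: space_bounded].
Qed.

Lemma run_seq c1 c2 mem out t1 t2 Q :
  run c1 mem out t1 (fun m o => run c2 m o t2 Q) ->
  run (Seq c1 c2) mem out (t1 + t2) Q.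
Proof.
move=> H /H[u1 [b1 [m1 [o1 [ex1 le1 B1 g1 /(_ g1)]]]]].
move=> [u2 [b2 [m2 [o2 [ex2 le2 B2 g2 q]]]]].
exists (u1 + u2), (maxn b1 b2), m2, o2; split=> //.
- exact: ExecSeq ex1 ex2.
- exact: leq_add.
- by rewrite geq_max B1.
Qed.

(** The sum of the two branch times replaces their maximum; this affects only constants and leaves
    linear arithmetic. *)
Lemma run_if e c1 c2 mem out t1 t2 Q :
  (eval inp mem e != 0 -> run c1 mem out t1 Q) ->
  (eval inp mem e = 0 -> run c2 mem out t2 Q) ->
  run (If e c1 c2) mem out (cost e + (t1 + t2)).+1 Q.
Proof.
move=> H1 H2 g.
have : run (if eval inp mem e != 0 then c1 else c2) mem out (t1 + t2) Q.
  case: eqP => [/H2 H|/eqP/H1 H]; apply: run_weaken H _ _ => //.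
    exact: leq_addl.
  exact: leq_addr.
move=> /(_ g)[t [b [m [o [ex le B g' q]]]]].
exists (cost e + t).+1, b, m, o; split=> //; first by constructor.
by rewrite ltnS leq_add2l.
Qed.

(* The first argument of [I] bounds the number of remaining iterations. *)
Lemma run_while (I : nat -> seq nat -> seq nat -> Prop) r e c mem out t Q :
  I r mem out ->
  (forall r m o, I r m o -> eval inp m e <> 0 -> 0 < r /\ run c m o t (I r.-1)) ->
  (forall r m o, I r m o -> eval inp m e = 0 -> Q m o) ->
  run (While e c) mem out (r * (cost e + t).+1 + (cost e).+1) Q.
Proof.
move=> I0 IS IQ; elim: r mem out I0 => [|r IH] m o Ir g.
all: case: (eval inp m e =P 0) => [e0|/[dup] e0 /(IS _ _ _ Ir)[//= _ Hc]].
1,2: exists (cost e).+1, (space m), m, o; split; [exact: ExecWhileEnd|lia|exact: space_bounded|by []|exact: (IQ _ _ _ Ir e0)].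
have [t1 [b1 [m1 [o1 [ex1 le1 B1 g1 I1]]]]] := Hc g.
have [t2 [b2 [m2 [o2 [ex2 le2 B2 g2 q]]]]] := IH _ _ I1 g1.
exists (cost e + t1 + t2).+1, (maxn b1 b2), m2, o2; split=> //.
- exact: ExecWhileStep ex1 ex2.
- by rewrite mulSn; lia.
- by rewrite geq_max B1.
Qed.

End ProgramLogic.

Definition Reg r := Read (Const r).

Definition for_loop r (N : expr) (body : com) : com :=
  Seq (Store (Const r) (Const 0))
    (While (Bin Lt (Reg r) N)
      (Seq body (Store (Const r) (Bin Add (Reg r) (Const 1))))).

(** [N] is evaluated anew in each round, so the limit may grow while the loop runs, as it does for
    the list of covectors used as a queue; [M] bounds the rounds in advance. The body must preserve
    the counter, which is advanced inside the invariant. *)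
Lemma run_for inp msize lim (I : nat -> seq nat -> seq nat -> Prop) M r N body mem out t Q :
  r < msize -> M <= lim r ->
  I 0 (set_nth 0 mem r 0) out ->
  (forall x m o, I x m o -> cell m r = x -> x < eval inp m N ->
    x < M /\ run inp msize lim body m o t (fun m' o' =>
      cell m' r = x /\ I x.+1 (set_nth 0 m' r x.+1) o')) ->
  (forall x m o, I x m o -> cell m r = x -> eval inp m N <= x -> Q m o) ->
  run inp msize lim (for_loop r N body) mem out (M * (cost N + t + 11) + cost N + 8) Q.
Proof.
move=> rS ML I0 IS IQ.
have R0 : run inp msize lim (for_loop r N body) mem out (3 + (M * (cost (Bin Lt (Reg r) N) + (t + 6)).+1 + (cost (Bin Lt (Reg r) N)).+1)) Q.
  apply: run_seq; apply: run_store => //=.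
  apply: (run_while (I := fun y m o => exists x, [/\ y = M - x, I x m o & cell m r = x])).
  - by exists 0; rewrite subn0 cell_set eqxx.
  - move=> y m o [x [yE Ix mr]] /=; rewrite mr; case: ltnP => // xN _.
    have [xM H] := IS x m o Ix mr xN; split; first by lia.
    apply: run_seq; apply: run_weaken H (leqnn _) _ => m' o' [mr' Ix'].
    apply: run_store => //=; rewrite mr' addn1; first by apply: leq_trans xM ML.
    by exists x.+1; split; [lia|by []|rewrite cell_set eqxx].
  - move=> y m o [x [yE Ix mr]] /=; rewrite mr; case: ltnP => // le _.
    exact: IQ Ix mr le.
apply: run_weaken R0 _ _ => //=; nia.
Qed.

(** * The program *)

(* Registers: 0 number of covectors found, 1 current covector, 2 current
   cocircuit, 3 ground set element, 4 second cocircuit, 5 node and 6 depth of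
   the search, 7 to 13 flags.  From address 16 on, the slot of covector [x]
   consists of two child pointers and the sign vector. *)
Definition input_k := Input (Const 0).
Definition input_n := Input (Const 1).
Definition slot (x o : expr) : expr :=
  Bin Add (Const 16) (Bin Add (Bin Mul x (Bin Add input_k (Const 2))) o).
Definition key_addr (x i : expr) := slot x (Bin Add (Const 2) i).
Definition key_at (x i : expr) := Read (key_addr x i).
Definition child_at (x b : expr) := Read (slot x b).
Definition cocircuit_at (j i : expr) :=
  Input (Bin Add (Const 2) (Bin Add (Bin Mul j input_k) i)).
Definition is0 (e : expr) := Bin Eq e (Const 0).
Definition set_reg r e := Store (Const r) e.
Definition incr r := set_reg r (Bin Add (Reg r) (Const 1)).

Definition any_element f (e : expr) : com :=
  Seq (set_reg f (Const 0))
      (for_loop 3 input_k (If e (set_reg f (Const 1)) Skip)).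

(** The contribution of cocircuit [j] to the composition: added to the sign of the current covector
    it gives the composed sign, and it is nonzero exactly where the composition differs from that
    covector. *)
Definition free_sign j := Bin Mul (is0 (key_at (Reg 1) (Reg 3))) (cocircuit_at (Reg j) (Reg 3)).
Definition differs x y := is0 (Bin Eq x y).

(* The composition is written to the slot after the last covector found, where
   it stays if it is new. *)
Definition write_composition : com :=
  for_loop 3 input_k
    (Store (key_addr (Reg 0) (Reg 3))
       (Bin Add (key_at (Reg 1) (Reg 3)) (free_sign 2))).

Definition compare_keys : com :=
  any_element 7 (differs (key_at (Reg 5) (Reg 3)) (key_at (Reg 0) (Reg 3))).

Definition branch : com :=
  any_element 8 (Bin Mul (cocircuit_at (Reg 6) (Reg 3))
    (differs (cocircuit_at (Reg 6) (Reg 3)) (key_at (Reg 0) (Reg 3)))).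

(* In place of a missing child, the new slot is linked; since its key is the
   vector sought, this ends the search. *)
Definition search_step : com :=
  Seq branch
  (Seq (If (child_at (Reg 5) (Reg 8))
          (set_reg 5 (child_at (Reg 5) (Reg 8)))
          (Seq (Store (slot (Reg 5) (Reg 8)) (Reg 0)) (set_reg 5 (Reg 0))))
  (Seq (incr 6) compare_keys)).

Definition search : com :=
  Seq (set_reg 5 (Const 0)) (Seq (set_reg 6 (Const 0))
  (Seq compare_keys (While (Reg 7) search_step))).

(** The search ends at the free slot exactly when the vector is new; only then does advancing the
    counter make the slot permanent. *)
Definition output_new : com :=
  If (Bin Eq (Reg 5) (Reg 0))
    (Seq (Output (Const 2))
    (Seq (for_loop 3 input_k (Output (key_at (Reg 5) (Reg 3)))) (incr 0)))
    Skip.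

(** For the current covector [v] below the candidate [w], the vector [v o c'] need not be written
    down: comparing it with [v] and [w] involves only the zeros of [v], where it equals [c']. The
    flags 11, 12 and 13 say that it differs from [v], is not below [w], and differs from [w]. *)
Definition check_minimal : com :=
  Seq (set_reg 9 (Const 1))
  (for_loop 4 input_n
    (Seq (any_element 11 (free_sign 4))
    (Seq (any_element 12 (Bin Mul (free_sign 4)
            (differs (cocircuit_at (Reg 4) (Reg 3)) (key_at (Reg 5) (Reg 3)))))
    (Seq (any_element 13 (Bin Mul (is0 (key_at (Reg 1) (Reg 3)))
            (differs (cocircuit_at (Reg 4) (Reg 3)) (key_at (Reg 5) (Reg 3)))))
      (If (Bin Mul (Reg 11) (Bin Mul (is0 (Reg 12))
             (Bin Add (Reg 13) (Bin Lt (Reg 4) (Reg 2)))))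
        (set_reg 9 (Const 0)) Skip))))).

Definition output_arc (target : expr) : com :=
  Seq (Output (Const 3)) (Seq (Output (Bin Add (Reg 1) (Const 1))) (Output target)).

Definition cocircuit_body : com :=
  Seq (any_element 7 (free_sign 2))
  (If (Reg 7)
    (Seq write_composition (Seq search (Seq output_new (Seq check_minimal
      (If (Reg 9)
        (Seq (output_arc (Bin Add (Reg 5) (Const 1))) (set_reg 10 (Const 1)))
        Skip)))))
    Skip).

Definition covector_body : com :=
  Seq (set_reg 10 (Const 0))
  (Seq (for_loop 2 input_n cocircuit_body)
    (If (Reg 10) Skip (output_arc (Const 0)))).

(** The first two outputs are the records of the maximum and of 0. Slot 0 is left as it is: its
    zeros already encode the zero covector with null pointers. *)
Definition hasse_program : com :=
  Seq (Output (Const 0)) (Seq (Output (Const 1)) (Seq (set_reg 0 (Const 1))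
    (for_loop 1 (Reg 0) covector_body))).

(** * Correctness of the program *)

Section Correctness.
Variables (k : nat) (V : {set signvec k}) (s : seq (signvec k)).
Hypothesis omV : is_oriented_matroid V.
Hypothesis sV : s =i cocircuits V.
Implicit Types (u v w c : signvec k) (ks : seq (signvec k)) (mem out : seq nat).

(** * Numerical codes of sign vectors *)

Definition vget v x := nth 0 (sv_code v) x.

Lemma vgetE v (i : 'I_k) : vget v i = sign_code (v i).
Proof. by rewrite /vget (nth_map i) ?size_enum_ord // nth_ord_enum. Qed.

Lemma vget_le2 v x : vget v x <= 2.
Proof.
have [xk|kx] := ltnP x k; first by rewrite (vgetE v (Ordinal xk)); case: (v _).
by rewrite /vget nth_default // size_map size_enum_ord.
Qed.

Lemma vget0 x : vget (sv0 k) x = 0.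
Proof.
have [xk|kx] := ltnP x k; first by rewrite (vgetE _ (Ordinal xk)) ffunE.
by rewrite /vget nth_default // size_map size_enum_ord.
Qed.

Lemma has_element P : has P (iota 0 k) = [exists i : 'I_k, P i].
Proof.
apply/hasP/existsP => [[x]|[i Pi]]; last by exists (val i) => //; rewrite mem_iota /=.
by rewrite mem_iota /= => xk Px; exists (Ordinal xk).
Qed.

Lemma has_comp_neq v c :
  has (fun x => (vget v x == 0) && (vget c x != 0)) (iota 0 k) = (sv_comp v c != v).
Proof.
rewrite has_element; apply/existsP/idP => [[i]|nvc].
  rewrite !vgetE => H; apply: contraTneq H => /ffunP/(_ i); rewrite ffunE.
  by case: (v i) (c i) => [] [].
apply/existsP; apply: contraNT nvc => /existsPn H; apply/eqP/ffunP => i.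
by have := H i; rewrite !vgetE ffunE; case: (v i) (c i) => [] [].
Qed.

Lemma has_neq u v :
  has (fun x => vget u x != vget v x) (iota 0 k) = (u != v).
Proof.
rewrite has_element; apply/existsP/idP => [[i]|nvc].
  by apply: contraNneq => ->.
apply/existsP; apply: contraNT nvc => /existsPn H; apply/eqP/ffunP => i.
by have := H i; rewrite !vgetE; case: (v i) (u i) => [] [].
Qed.

Lemma has_nle c w :
  has (fun x => (vget c x != 0) && (vget c x != vget w x)) (iota 0 k) = ~~ sv_le c w.
Proof.
rewrite has_element negb_forall; apply: eq_existsb => i.
by rewrite !vgetE; case: (c i) (w i) => [] [].
Qed.

Lemma has_comp_nle v c w : sv_le v w ->
  has (fun x => [&& vget v x == 0, vget c x != 0 & vget c x != vget w x]) (iota 0 k)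
  = ~~ sv_le (sv_comp v c) w.
Proof.
move=> /forallP vw; rewrite has_element negb_forall; apply: eq_existsb => i.
by have := vw i; rewrite !vgetE ffunE; case: (v i) (c i) (w i) => [] [] [].
Qed.

Lemma has_comp_neq_above v c w : sv_le v w ->
  has (fun x => (vget v x == 0) && (vget c x != vget w x)) (iota 0 k)
  = (sv_comp v c != w).
Proof.
move=> /forallP vw; rewrite -has_neq !has_element; apply: eq_existsb => i.
by have := vw i; rewrite !vgetE ffunE; case: (v i) (c i) (w i) => [] [] [].
Qed.

Lemma vget_comp v c x :
  vget (sv_comp v c) x = vget v x + (vget v x == 0) * vget c x.
Proof.
have [xk|kx] := ltnP x k.
  by rewrite !(vgetE _ (Ordinal xk)) ffunE; case: (v _); rewrite /= ?mul1n ?mul0n ?addn0.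
by rewrite /vget !nth_default // size_map size_enum_ord.
Qed.

Local Notation inp := (input_code s).
Local Notation phi := #|V|.
Local Notation key ks x := (nth (sv0 k) ks x).
Local Notation coc j := (nth (sv0 k) s j).

Lemma input_cocircuit j x : j < size s -> x < k ->
  cell inp (2 + (j * k + x)) = vget (coc j) x.
Proof.
move=> js xk; rewrite add2n /=.
elim: s j js => //= c s' IH [|j] js.
  by rewrite mul0n add0n nth_cat size_map size_enum_ord xk.
by rewrite mulSn nth_cat size_map size_enum_ord -addnA ltnNge leq_addr addKn IH.
Qed.

Lemma input_cell0 : cell inp 0 = k. Proof. by []. Qed.
Local Arguments nth : simpl never.
Local Arguments set_nth : simpl never.

(** * Memory layout *)

Definition kaddr x i := 16 + (x * (k + 2) + (2 + i)).
Definition paddr x b := 16 + (x * (k + 2) + b).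

(** The extra slot holds a composition tested after all covectors have been found. *)
Definition msize := 16 + (phi + 1) * (k + 2).
(* Bounding each cell by a function of its address reduces the space bound to a
   local condition on every store. *)
Definition lim a :=
  if a < 16 then phi + size s + k
  else if (a - 16) %% (k + 2) < 2 then phi else 2.

Local Notation run := (run inp msize lim).

Lemma reg_lt_msize r : r < 16 -> r < msize.
Proof. rewrite /msize; lia. Qed.

Lemma lim_reg r : r < 16 -> lim r = phi + size s + k.
Proof. by rewrite /lim => ->. Qed.

Lemma slot_lt_msize x o : x <= phi -> o < k + 2 -> 16 + (x * (k + 2) + o) < msize.
Proof. rewrite /msize; nia. Qed.

Lemma lim_kaddr x i : i < k -> lim (kaddr x i) = 2.
Proof.
by move=> ik; rewrite /lim /kaddr addKn modnMDl modn_small //=; lia.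
Qed.

Lemma lim_paddr x (b : bool) : lim (paddr x b) = phi.
Proof.
rewrite /lim /paddr addKn modnMDl modn_small; last by case: b; lia.
by case: b.
Qed.

Lemma slot_inj x y o o' : o < k + 2 -> o' < k + 2 ->
  (16 + (x * (k + 2) + o) == 16 + (y * (k + 2) + o')) = (x == y) && (o == o').
Proof.
move=> ok ok'; rewrite eqn_add2l; apply/eqP/andP => [E|[/eqP-> /eqP->]] //.
have xE : x = y.
  by have := congr1 (divn^~ (k + 2)) E; rewrite /= !divnMDl ?divn_small ?addn0 // addn2.
by split; apply/eqP => //; apply/eqP; rewrite -(eqn_add2l (x * (k + 2))) E xE.
Qed.

(** * Frame conditions and passes over the ground set *)

Definition frame (X : seq nat) mem mem' := forall a, a \notin X -> cell mem' a = cell mem a.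

Lemma frame_trans X m1 m2 m3 : frame X m1 m2 -> frame X m2 m3 -> frame X m1 m3.
Proof. by move=> H1 H2 a aX; rewrite H2 ?H1. Qed.

Lemma frame_weaken X Y m1 m2 : {subset X <= Y} -> frame X m1 m2 -> frame Y m1 m2.
Proof. by move=> XY H a aY; apply: H; apply: contra aY; apply: XY. Qed.

Lemma frame_set X mem r (v : nat) : r \in X -> frame X mem (set_nth 0 mem r v).
Proof. by move=> rX a aX; rewrite cell_set; case: eqP aX => // ->; rewrite rX. Qed.

Lemma run_set_reg r e mem out Q : r < 16 ->
  eval inp mem e <= phi + size s + k ->
  Q (set_nth 0 mem r (eval inp mem e)) out ->
  run (set_reg r e) mem out (cost e).+2 Q.
Proof. by move=> r16 le q; apply: run_store; rewrite //= ?reg_lt_msize ?lim_reg. Qed.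

Lemma phi_gt0 : 0 < phi.
Proof. by apply/card_gt0P; exists (sv0 k); apply: om_zero omV. Qed.

Lemma run_any_element f e P mem out : f < 16 -> f != 3 ->
  (forall x m, x < k -> frame [:: f; 3] mem m -> cell m 3 = x ->
     (eval inp m e != 0) = P x) ->
  run (any_element f e) mem out ((cost e + 40) * k.+1) (fun m o =>
    [/\ o = out, cell m f = has P (iota 0 k) & frame [:: f; 3] mem m]).
Proof.
move=> f16 f3 He; have gt0 := phi_gt0.
have f3' : (3 == f) = false by rewrite eq_sym (negbTE f3).
suff H : run (any_element f e) mem out (3 + (k * (2 + (cost e + 4).+1 + 11) + 2 + 8)) (fun m o =>
    [/\ o = out, cell m f = has P (iota 0 k) & frame [:: f; 3] mem m]).
  by apply: run_weaken H _ _ => //; nia.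
apply: run_seq; apply: run_set_reg => //=.
apply: (run_for (I := fun x m o =>
  [/\ o = out, cell m f = has P (iota 0 x), x <= k & frame [:: f; 3] mem m])).
- exact: reg_lt_msize.
- by rewrite lim_reg //; apply: leq_addl.
- rewrite !cell_set (negbTE f3) eqxx; split=> //.
  by apply: (frame_trans (m2 := set_nth 0 mem f 0)); apply: frame_set; rewrite !inE eqxx ?orbT.
- move=> x m o [-> mf xk fr] m3 /=; rewrite input_cell0 => {}xk; split=> //.
  have hasS : P 0 || has P (iota 1 x) = has P (iota 0 x) || P x.
    by rewrite -[LHS]/(has P (iota 0 x.+1)) -addn1 iotaD has_cat /= orbF.
  apply: run_time; first apply: (run_if (t1 := 3) (t2 := 1)).
  + move=> en; apply: run_set_reg => //=; first by lia.
    have Px : P x by rewrite -(He x m).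
    rewrite cell_set f3'; split=> //; split=> //.
      by rewrite !cell_set (negbTE f3) eqxx /= hasS Px orbT.
    by do 2?[apply: frame_trans; last by apply: frame_set; rewrite !inE eqxx ?orbT].
  + move=> e0; apply: run_skip.
    have Px : P x = false by rewrite -(He x m) // e0.
    split=> //; split=> //.
      by rewrite cell_set (negbTE f3) /= hasS Px orbF.
    by apply: frame_trans fr _; apply: frame_set; rewrite !inE eqxx ?orbT.
  + by lia.
move=> x m o [-> mf xk fr] m3 /=; rewrite input_cell0 => kx.
by have -> : k = x by apply/eqP; rewrite eqn_leq kx.
Qed.


Lemma eval_const m x : eval inp m (Const x) = x. Proof. by []. Qed.
Lemma eval_reg m r : eval inp m (Reg r) = cell m r. Proof. by []. Qed.
Lemma eval_add m e1 e2 : eval inp m (Bin Add e1 e2) = eval inp m e1 + eval inp m e2.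
Proof. by []. Qed.
Lemma eval_key_addr m x i : eval inp m (key_addr x i) = kaddr (eval inp m x) (eval inp m i).
Proof. by []. Qed.
Lemma eval_slot m x b : eval inp m (slot x b) = paddr (eval inp m x) (eval inp m b).
Proof. by []. Qed.
Lemma eval_key_at m x i : eval inp m (key_at x i) = cell m (kaddr (eval inp m x) (eval inp m i)).
Proof. by []. Qed.
Lemma eval_child_at m x b : eval inp m (child_at x b) = cell m (paddr (eval inp m x) (eval inp m b)).
Proof. by []. Qed.
Lemma eval_cocircuit_at m j i : eval inp m j < size s -> eval inp m i < k ->
  eval inp m (cocircuit_at j i) = vget (coc (eval inp m j)) (eval inp m i).
Proof. exact: input_cocircuit. Qed.
Lemma eval_is0 m e : eval inp m (is0 e) = (eval inp m e == 0). Proof. by []. Qed.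
Lemma eval_mul m e1 e2 : eval inp m (Bin Mul e1 e2) = eval inp m e1 * eval inp m e2.
Proof. by []. Qed.

Definition evalE := (eval_const, eval_reg, eval_key_addr, eval_slot, eval_key_at,
  eval_child_at, eval_is0, eval_add, eval_mul).

Lemma test_mul m e1 e2 :
  (eval inp m (Bin Mul e1 e2) != 0) = (eval inp m e1 != 0) && (eval inp m e2 != 0).
Proof. by rewrite /= muln_eq0 negb_or. Qed.
Lemma test_add m e1 e2 :
  (eval inp m (Bin Add e1 e2) != 0) = (eval inp m e1 != 0) || (eval inp m e2 != 0).
Proof. by rewrite /= addn_eq0 negb_and. Qed.
Lemma test_is0 m e : (eval inp m (is0 e) != 0) = (eval inp m e == 0).
Proof. by rewrite eval_is0 eqb0 negbK. Qed.
Lemma test_differs m e1 e2 :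
  (eval inp m (differs e1 e2) != 0) = (eval inp m e1 != eval inp m e2).
Proof. by rewrite test_is0 /= eqb0. Qed.
Lemma test_lt m e1 e2 : (eval inp m (Bin Lt e1 e2) != 0) = (eval inp m e1 < eval inp m e2).
Proof. by rewrite /= eqb0 negbK. Qed.
Definition testE := (test_mul, test_add, test_differs, test_is0, test_lt).

Lemma frame_kaddr X m m' x i : all (gtn 16) X -> frame X m m' ->
  cell m' (kaddr x i) = cell m (kaddr x i).
Proof. by move=> /allP X16 -> //; apply/negP=> /X16 /=; rewrite /kaddr; lia. Qed.

Lemma frame_paddr X m m' x b : all (gtn 16) X -> frame X m m' ->
  cell m' (paddr x b) = cell m (paddr x b).
Proof. by move=> /allP X16 -> //; apply/negP=> /X16 /=; rewrite /paddr; lia. Qed.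

(** A generous bound for one pass over the ground set; [k.+1] keeps it above 200 even for [k = 0],
    so that it also absorbs constant overheads. *)
Definition any_time := 200 * k.+1.

Lemma run_compare_keys u w mem out :
  (forall x, x < k -> cell mem (kaddr (cell mem 5) x) = vget u x) ->
  (forall x, x < k -> cell mem (kaddr (cell mem 0) x) = vget w x) ->
  run compare_keys mem out any_time (fun m o =>
    [/\ o = out, cell m 7 = (u != w) & frame [:: 7; 3] mem m]).
Proof.
move=> Hu Hw; rewrite -has_neq; apply: run_time.
  apply: (run_any_element (P := fun x => vget u x != vget w x)) => // x m xk fr m3.
  by rewrite testE !evalE m3 !(frame_kaddr _ _ _ fr) // !fr // Hu // Hw.
by rewrite leq_mul2r /=.
Qed.

Lemma run_branch w mem out : cell mem 6 < size s ->
  (forall x, x < k -> cell mem (kaddr (cell mem 0) x) = vget w x) ->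
  run branch mem out any_time (fun m o =>
    [/\ o = out, cell m 8 = ~~ sv_le (coc (cell mem 6)) w & frame [:: 8; 3] mem m]).
Proof.
move=> ds Hw; rewrite -has_nle; apply: run_time.
  apply: run_any_element => // x m xk fr m3.
  rewrite !testE eval_cocircuit_at !evalE ?m3 // ?(frame_kaddr _ _ _ fr) // ?fr //.
  by rewrite Hw.
by rewrite leq_mul2r /=.
Qed.

Lemma run_write_composition v mem out :
  cell mem 0 <= phi -> cell mem 1 != cell mem 0 -> cell mem 2 < size s ->
  (forall x, x < k -> cell mem (kaddr (cell mem 1) x) = vget v x) ->
  run write_composition mem out any_time (fun m o =>
    [/\ o = out,
     forall x, x < k -> cell m (kaddr (cell mem 0) x) = vget (sv_comp v (coc (cell mem 2))) x &
     forall a, a != 3 -> (forall x, x < k -> a != kaddr (cell mem 0) x) ->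
       cell m a = cell mem a]).
Proof.
move=> cphi pc js Hv; apply: run_time.
apply: (run_for (M := k) (t := 100) (I := fun y m o =>
   [/\ o = out, y <= k,
     forall x, x < y -> cell m (kaddr (cell mem 0) x) = vget (sv_comp v (coc (cell mem 2))) x &
     forall a, a != 3 -> (forall x, x < k -> a != kaddr (cell mem 0) x) ->
       cell m a = cell mem a])).
- exact: reg_lt_msize.
- by rewrite lim_reg //; apply: leq_addl.
- split=> // a a3 _; by rewrite cell_set (negbTE a3).
- move=> y m o [-> _ Hy fr] m3 /=; rewrite input_cell0 => yk; split=> //.
  have kne r i : r < 16 -> i < k -> r != kaddr (cell mem 0) i.
    by rewrite /kaddr => ? ?; lia.
  have [m0 m1 m2] : [/\ cell m 0 = cell mem 0, cell m 1 = cell mem 1 & cell m 2 = cell mem 2].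
    by split; apply: fr => // x xk; apply: kne.
  have mp : cell m (kaddr (cell mem 1) y) = vget v y.
    rewrite fr ?Hv // => x xk; rewrite /kaddr slot_inj ?(negbTE pc) //; lia.
  have ev : eval inp m (Bin Add (key_at (Reg 1) (Reg 3)) (free_sign 2)) =
            vget (sv_comp v (coc (cell mem 2))) y.
    by rewrite vget_comp !evalE eval_cocircuit_at !evalE ?m3 ?m1 ?m2 // mp.
  apply: run_time; first apply: run_store.
  + rewrite !evalE m0 m3; apply: slot_lt_msize => //; lia.
  + by rewrite ev !evalE m3 lim_kaddr // vget_le2.
  + rewrite ev !evalE m0 m3 cell_set [3 == _](negbTE (kne _ _ _ _)) //; split=> //; split=> //.
      move=> x; rewrite ltnS leq_eqVlt => /predU1P[->|xy].
        by rewrite !cell_set [_ == 3]eq_sym (negbTE (kne _ _ _ _)) // eqxx.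
      have xk : x < k by apply: ltn_trans yk.
      rewrite !cell_set [_ == 3]eq_sym (negbTE (kne _ _ _ _)) // /kaddr slot_inj ?eqxx /= ?eqn_add2l; try lia.
      by rewrite (ltn_eqF xy) -Hy.
    by move=> a a3 ak; rewrite !cell_set (negbTE a3) (negbTE (ak _ _)) // fr.
  + by [].
- move=> y m o [-> yk Hy fr] m3 /=; rewrite input_cell0 => ky.
  by split=> // x xk; apply: Hy; apply: leq_trans ky.
by rewrite /any_time /=; lia.
Qed.


Lemma any_time_ge : 200 <= any_time.
Proof. by rewrite leq_pmulr. Qed.

Definition search_regs := [:: 3; 5; 6; 7; 8].

Definition search_frame mem mem' :=
  forall a, a \notin search_regs -> (forall x (b : bool), a != paddr x b) ->
    cell mem' a = cell mem a.

Lemma search_frame_trans X m1 m2 m3 :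
  all (mem search_regs) X -> search_frame m1 m2 -> frame X m2 m3 -> search_frame m1 m3.
Proof.
move=> /allP XR H fr a aR ap; rewrite fr ?H //.
by apply: contra aR => /XR.
Qed.

Lemma search_frame_reg m1 m2 r : search_frame m1 m2 -> r < 16 -> r \notin search_regs ->
  cell m2 r = cell m1 r.
Proof. by move=> H r16 rR; apply: H => // x b; rewrite /paddr; lia. Qed.

Lemma kaddr_paddr x i y (b : bool) : i < k -> (kaddr x i == paddr y b) = false.
Proof.
move=> ik; have bk : b < k + 2 by case: b; lia.
have ik2 : 2 + i < k + 2 by lia.
by rewrite /kaddr /paddr slot_inj // andbC; case: b {bk}.
Qed.

Lemma paddr_reg x b r : r < 16 -> (paddr x b == r) = false.
Proof. by rewrite /paddr; lia. Qed.

Lemma paddr_inj x y (b c : bool) : (paddr x b == paddr y c) = (x == y) && (b == c).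
Proof.
have bk (d : bool) : d < k + 2 by case: d; lia.
by rewrite /paddr slot_inj //; case: b c => [] [].
Qed.

Lemma search_frame_kaddr m1 m2 x i : search_frame m1 m2 -> i < k ->
  cell m2 (kaddr x i) = cell m1 (kaddr x i).
Proof.
move=> H ik; apply: H => [|y b]; last by rewrite kaddr_paddr.
by rewrite /kaddr !inE; lia.
Qed.

Definition search_time := (size s).+2 * (3 * any_time).

Lemma run_search ks ptr path w mem out :
  search_tree s ks ptr path -> {subset ks <= V} -> uniq ks -> w \in V ->
  0 < size ks <= phi -> cell mem 0 = size ks ->
  (forall x i, x < size ks -> i < k -> cell mem (kaddr x i) = vget (key ks x) i) ->
  (forall i, i < k -> cell mem (kaddr (size ks) i) = vget w i) ->
  (forall x (b : bool), cell mem (paddr x b) = ptr x b) ->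
  run search mem out search_time (fun m o => exists ks' ptr' path',
    [/\ [/\ o = out, ks' = (if w \in ks then ks else rcons ks w) & cell m 5 = index w ks'],
     search_tree s ks' ptr' path',
     forall x (b : bool), cell m (paddr x b) = ptr' x b & search_frame mem m]).
Proof.
move=> tree ksV ks_uniq Vw /andP[ks0 ks_phi] m0 keys keyw ptrs.
(* Either the search goes on in the unchanged tree, with [r] levels left, or the new slot has just
   been linked and flag 7 ends the loop. *)
pose I r m o := [/\ o = out, search_frame mem m &
  [/\ search_at s ks path w (cell m 5) (cell m 6), r = size s - cell m 6,
      forall x (b : bool), cell m (paddr x b) = ptr x b &
      cell m 7 = (key ks (cell m 5) != w)] \/
  [/\ w \notin ks, cell m 5 = size ks, cell m 7 = 0 &
      exists ptr' path', search_tree s (rcons ks w) ptr' path' /\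
        forall x (b : bool), cell m (paddr x b) = ptr' x b]].
have gt0 := any_time_ge.
have keysm m : search_frame mem m ->
   (forall x i, x < size ks -> i < k -> cell m (kaddr x i) = vget (key ks x) i) /\
   (forall i, i < k -> cell m (kaddr (cell m 0) i) = vget w i).
  move=> fr; split=> [x i xs ik|i ik]; first by rewrite (search_frame_kaddr _ fr) // keys.
  by rewrite (search_frame_reg (r := 0) fr) // (search_frame_kaddr _ fr) // m0 keyw.
apply: run_time; first apply: run_seq.
  apply: run_set_reg => //; apply: run_seq; apply: run_set_reg => //; apply: run_seq.
  set m := set_nth _ _ _ _.
  have frm : search_frame mem m.
    move=> a aR _; rewrite !cell_set; move: aR; rewrite !inE !negb_or.
    by case/and5P=> _ /negbTE-> /negbTE->.
  have m5 : cell m 5 = 0 by rewrite !cell_set.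
  have m6 : cell m 6 = 0 by rewrite !cell_set.
  have [km kwm] := keysm m frm.
  apply: run_weaken; first apply: (run_compare_keys (u := key ks 0) (w := w)) => //.
    by move=> x xk; rewrite m5 km.
    by [].
  move=> m1 o1 [-> m17 fr1].
  apply: (run_while (I := I) (r := size s)).
  - split=> //; first exact: (search_frame_trans _ frm fr1).
    left; split.
    + by rewrite !fr1 // m5 m6; apply: (search_at0 tree).
    + by rewrite fr1 // m6 subn0.
    + by move=> x b; rewrite (frame_paddr _ _ _ fr1) // !cell_set -ptrs.
    + by rewrite m17 fr1 // m5.
  - move=> {m frm m5 m6 km kwm m1 o1 m17 fr1} r m o [-> frm [[at_qd rE pm m7]|[_ _ m7 _]]] ;
      rewrite eval_reg m7 // => /eqP; rewrite eqb0 negbK => qw.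
    have dn := search_lt omV sV tree ksV Vw at_qd qw.
    split; first by rewrite rE; lia.
    have [qs _ _ _] := at_qd.
    have [km kwm] := keysm m frm.
    apply: run_seq; apply: run_weaken; first apply: (run_branch (w := w)) => //; first by [].
    move=> m1 o1 [-> m1b fr1].
    have frm1 : search_frame mem m1 by apply: (search_frame_trans _ frm fr1).
    have m15 : cell m1 5 = cell m 5 by rewrite fr1.
    have m16 : cell m1 6 = cell m 6 by rewrite fr1.
    have pm1 x (b : bool) : cell m1 (paddr x b) = ptr x b by rewrite (frame_paddr _ _ _ fr1).
    set b := ~~ _ in m1b.
    apply: run_seq; apply: run_if.
    + rewrite !evalE m15 m1b pm1 => pb.
      apply: run_set_reg => //.
        rewrite !evalE m15 m1b pm1; have [cs _] := st_child tree qs pb; lia.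
      rewrite !evalE m15 m1b pm1.
      set m2 := set_nth _ _ _ _.
      have atq := search_child omV sV tree ksV Vw at_qd qw pb.
      have [qs' _ _ _] := atq.
      apply: run_seq; apply: run_set_reg => //.
        by rewrite !evalE cell_set /= m16; lia.
      rewrite !evalE [cell m2 6]cell_set /= m16 addn1.
      set m3 := set_nth _ _ _ _.
      have frm3 : search_frame mem m3.
        apply: (search_frame_trans (X := search_regs)) frm1 _ => //.
        by apply: (frame_trans (m2 := m2)); apply: frame_set.
      have m35 : cell m3 5 = ptr (cell m 5) b by rewrite !cell_set.
      have m36 : cell m3 6 = (cell m 6).+1 by rewrite !cell_set.
      have [km3 kwm3] := keysm m3 frm3.
      apply: run_weaken; first apply: (run_compare_keys (u := key ks (cell m3 5)) (w := w)) => //.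
        by move=> x xk; rewrite km3 // m35.
        by [].
      move=> m4 o4 [-> m47 fr4]; split=> //; first exact: (search_frame_trans _ frm3 fr4).
      left; split.
      * by rewrite !fr4 // m35 m36.
      * by rewrite fr4 // m36 rE; lia.
      * by move=> x c; rewrite (frame_paddr _ _ _ fr4) // !cell_set -[RHS]pm1.
      * by rewrite m47 fr4.
    + rewrite !evalE m15 m1b pm1 => pb0.
      have wks := search_notin omV sV tree ksV Vw at_qd qw pb0.
      apply: run_seq; apply: run_store.
      * rewrite !evalE m15 m1b; apply: slot_lt_msize; last by case: (b); lia.
        exact: leq_trans (ltnW qs) ks_phi.
      * by rewrite !evalE m15 m1b lim_paddr (search_frame_reg frm1) // m0.
      rewrite !evalE m15 m1b.
      have -> : cell m1 0 = size ks by rewrite (search_frame_reg frm1).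
      set m2 := set_nth _ _ _ _.
      have m20 : cell m2 0 = size ks.
        by rewrite cell_set (search_frame_reg frm1).
      have m26 : cell m2 6 = cell m 6 by rewrite cell_set.
      apply: run_set_reg => //; first by rewrite evalE m20; lia.
      rewrite evalE m20; apply: run_seq; apply: run_set_reg => //.
        by rewrite !evalE cell_set /= m26; lia.
      rewrite !evalE [cell (set_nth 0 m2 5 _) 6]cell_set /= m26 addn1.
      set m3 := set_nth _ _ _ _.
      have frm3 : search_frame mem m3.
        move=> a aR ap; rewrite !cell_set (negbTE (ap _ _)) (frm1 a) //.
        move: aR; rewrite !inE !negb_or.
        by case/and5P=> _ /negbTE-> /negbTE->.
      have m35 : cell m3 5 = size ks by rewrite !cell_set.
      have [km3 kwm3] := keysm m3 frm3.
      apply: run_weaken; first apply: (run_compare_keys (u := w) (w := w)) => //.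
        by move=> x xk; rewrite m35 (search_frame_kaddr _ frm3) // keyw.
        by [].
      move=> m4 o4 [-> m47 fr4]; split=> //; first exact: (search_frame_trans _ frm3 fr4).
      right; split=> //; first by rewrite fr4.
        by rewrite m47 eqxx.
      pose ptr' x (c : bool) := if (x == cell m 5) && (c == b) then size ks else ptr x c.
      have tree' := search_insert omV sV tree ksV Vw at_qd qw pb0 (ptr' := ptr') (fun _ _ => erefl).
      exists ptr', (fun x => if x == size ks then rcons (path (cell m 5)) b else path x).
      split=> // x c; rewrite (frame_paddr _ _ _ fr4) // !cell_set paddr_inj pm1 !paddr_reg //.
  - move=> {m frm m5 m6 km kwm m1 o1 m17 fr1} r m o [-> frm H]; rewrite eval_reg => m7.
    case: H => [[at_qd _ pm]|[wks m5 _ [ptr' [path' [tree' pm]]]]].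
      rewrite m7 => /esym/eqP; rewrite eqb0 negbK => /eqP qw.
      have [qs _ _ _] := at_qd.
      have wks : w \in ks by rewrite -qw mem_nth.
      exists ks, ptr, path; split=> //; split=> //; first by rewrite wks.
      by rewrite -qw index_uniq.
    exists (rcons ks w), ptr', path'; split=> //; split=> //; first by rewrite (negbTE wks).
    by rewrite m5 -cats1 index_cat (negbTE wks) /= eqxx addn0.
rewrite /search_time /=.
have : size s * 200 <= size s * any_time by rewrite leq_mul2l any_time_ge orbT.
nia.
Qed.


Lemma iotaS y : iota 0 y.+1 = rcons (iota 0 y) y.
Proof. by rewrite -addn1 iotaD cats1. Qed.

Lemma sv_code_vget w : sv_code w = [seq vget w x | x <- iota 0 k].
Proof.
have -> : iota 0 k = iota 0 (size (sv_code w)) by rewrite size_map size_enum_ord.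
by rewrite -[LHS](mkseq_nth 0).
Qed.

Lemma run_output_new ks w mem out :
  let ks' := if w \in ks then ks else rcons ks w in
  size ks' <= phi ->
  cell mem 0 = size ks -> cell mem 5 = index w ks' ->
  (forall x, x < k -> cell mem (kaddr (cell mem 5) x) = vget w x) ->
  run output_new mem out (2 * any_time) (fun m o =>
    [/\ o = out ++ (if w \in ks then [::] else 2 :: sv_code w),
        cell m 0 = size ks' & frame [:: 0; 3] mem m]).
Proof.
move=> ks' le m0 m5 keyw; apply: run_time; first apply: run_if => /= [|/eqP].
- rewrite eqb0 negbK m0 m5 => /eqP iw.
  have wks : w \in ks = false.
    apply/negP=> wks; move: iw; rewrite /ks' wks => iw.
    by move: wks; rewrite -index_mem iw ltnn.
  rewrite wks; apply: run_seq; apply: run_output; apply: run_seq.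
  apply: (run_for (M := k) (t := 100) (I := fun y m o =>
    [/\ o = out ++ 2 :: [seq vget w x | x <- iota 0 y], y <= k & frame [:: 3] mem m])).
  + exact: reg_lt_msize.
  + by rewrite lim_reg //; apply: leq_addl.
  + by rewrite cats1; split=> //; apply: frame_set.
  + move=> y m o [-> _ fr] m3 yk'; have {yk'}yk : y < k := yk'; split=> //.
    apply: run_time; first apply: run_output; last by [].
    split=> //; split=> //; last by apply: frame_trans fr _; apply: frame_set.
    have -> : eval inp m (key_at (Reg 5) (Reg 3)) = vget w y.
      by rewrite !evalE m3 (frame_kaddr _ _ _ fr) // fr // keyw.
    by rewrite iotaS map_rcons rcons_cat.
  + move=> y m o [-> yk fr] m3 /=; rewrite input_cell0 => ky.
    have {}yk : y = k by apply/eqP; rewrite eqn_leq yk.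
    have cnt : (cell m 0).+1 = size ks'.
      by rewrite /ks' wks size_rcons fr // m0. 
    apply: run_set_reg => //; rewrite !evalE addn1 cnt; first by lia.
    rewrite cell_set /=; split=> //; first by rewrite yk sv_code_vget.
    apply: (frame_trans (m2 := m)); last exact: frame_set.
    by apply: frame_weaken fr => a; rewrite !inE => ->; rewrite orbT.
- rewrite eqb0 m0 m5 => iw; apply: run_skip.
  have wks : w \in ks.
    apply: contraR iw => wks; rewrite /ks' (negbTE wks).
    by rewrite -cats1 index_cat (negbTE wks) /= eqxx addn0.
  by rewrite wks cats0 m0 /ks' wks.
by rewrite /any_time /=; lia.
Qed.

(* [l < j] excludes repeated arcs: of all cocircuits with the same composition,
   only the first one yields an arc. *)
Definition minimal_at v w j := all (fun l =>
  ~~ [&& sv_comp v (coc l) != v, sv_le (sv_comp v (coc l)) w &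
         (sv_comp v (coc l) != w) || (l < j)]) (iota 0 (size s)).

Definition check_regs := [:: 9; 4; 3; 11; 12; 13].

Lemma run_check_minimal v w mem out : sv_le v w ->
  (forall x, x < k -> cell mem (kaddr (cell mem 1) x) = vget v x) ->
  (forall x, x < k -> cell mem (kaddr (cell mem 5) x) = vget w x) ->
  run check_minimal mem out (size s * (4 * any_time) + any_time) (fun m o =>
    [/\ o = out, cell m 9 = minimal_at v w (cell mem 2) & frame check_regs mem m]).
Proof.
move=> vw Hv Hw; have gt0 := phi_gt0; have gt2 := any_time_ge.
pose test l := ~~ [&& sv_comp v (coc l) != v, sv_le (sv_comp v (coc l)) w &
         (sv_comp v (coc l) != w) || (l < cell mem 2)].
apply: run_time; first (apply: run_seq; apply: run_set_reg => //=; first by rewrite -addnA ltn_addr).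
  apply: (run_for (M := size s) (t := 3 * any_time + 100) (I := fun y m o =>
    [/\ o = out, cell m 9 = all test (iota 0 y), y <= size s & frame check_regs mem m])).
  - exact: reg_lt_msize.
  - by rewrite lim_reg // addnAC leq_addl.
  - rewrite !cell_set /=; split=> //.
    by apply: (frame_trans (m2 := set_nth 0 mem 9 1)); apply: frame_set.
  - move=> y m o [-> m9 _ fr] m4 ys'; have {ys'}ys : y < size s := ys'; split=> //.
    have evs m' i r : frame check_regs mem m' -> i < k -> cell m' 3 = i -> cell m' r = y ->
        [/\ eval inp m' (cocircuit_at (Reg r) (Reg 3)) = vget (coc y) i,
            eval inp m' (key_at (Reg 1) (Reg 3)) = vget v i &
            eval inp m' (key_at (Reg 5) (Reg 3)) = vget w i].
      move=> fr' ik m3 mr; rewrite eval_cocircuit_at ?evalE ?m3 ?mr //.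
      by rewrite !(frame_kaddr _ _ _ fr') // !fr' // Hv // Hw.
    have step m1 m2 X : frame X m1 m2 -> frame check_regs mem m1 ->
        cell m1 4 = y -> all [in check_regs] X -> 4 \notin X -> frame check_regs mem m2 /\ cell m2 4 = y.
      move=> fr2 fr1 m14 /allP XR X4; split; last by rewrite fr2.
      by apply: frame_trans fr1 _; apply: frame_weaken fr2.
    apply: run_time.
      apply: run_seq; apply: run_weaken; first apply: (run_any_element
        (P := fun x => (vget v x == 0) && (vget (coc y) x != 0))) => //.
        move=> x m' xk fr' m3; have [fr1 m14] := step _ _ _ fr' fr m4 isT isT.
        by have [e1 e2 e3] := evs _ _ _ fr1 xk m3 m14; rewrite !testE e1 e2.
        by [].
      move=> m1 o1 [-> m11 fr1'].
      have [{}fr1 m14] := step _ _ _ fr1' fr m4 isT isT.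
      apply: run_seq; apply: run_weaken; first apply: (run_any_element
        (P := fun x => [&& vget v x == 0, vget (coc y) x != 0 & vget (coc y) x != vget w x])) => //.
        move=> x m' xk fr' m3; have [fr2 m24] := step _ _ _ fr' fr1 m14 isT isT.
        by have [e1 e2 e3] := evs _ _ _ fr2 xk m3 m24; rewrite !testE e1 e2 e3 andbA.
        by [].
      move=> m2 o2 [-> m212 fr2'].
      have [{}fr2 m24] := step _ _ _ fr2' fr1 m14 isT isT.
      apply: run_seq; apply: run_weaken; first apply: (run_any_element
        (P := fun x => (vget v x == 0) && (vget (coc y) x != vget w x))) => //.
        move=> x m' xk fr' m3; have [fr3 m34] := step _ _ _ fr' fr2 m24 isT isT.
        by have [e1 e2 e3] := evs _ _ _ fr3 xk m3 m34; rewrite !testE e1 e2 e3.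
        by [].
      move=> m3 o3 [-> m313 fr3'].
      have [{}fr3 m34] := step _ _ _ fr3' fr2 m24 isT isT.
      have allS : all test (iota 0 y.+1) = all test (iota 0 y) && test y.
        by rewrite iotaS all_rcons andbC.
      have m39 : cell m3 9 = all test (iota 0 y) by rewrite fr3' // fr2' // fr1'.
      have testE' : (eval inp m3 (Bin Mul (Reg 11) (Bin Mul (is0 (Reg 12))
             (Bin Add (Reg 13) (Bin Lt (Reg 4) (Reg 2))))) != 0) = ~~ test y.
        rewrite !testE !evalE m34 m313 fr3' // fr2' // m11 fr3' // m212 fr3 //.
        rewrite has_comp_neq has_comp_nle // has_comp_neq_above // !eqb0 !negbK.
        by [].
      apply: run_if => [|/eqP]; last rewrite -[_ == _]negbK testE' negbK => ty.
        rewrite testE' => ty; apply: run_set_reg => //.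
        rewrite cell_set m34; split=> //; split=> //.
          by rewrite !cell_set allS (negbTE ty) andbF.
        apply: frame_trans fr3 _; apply: frame_trans (_ : frame _ _ (set_nth 0 m3 9 0)) _;
          exact: frame_set.
      apply: run_skip; split=> //; split=> //; first by rewrite cell_set m39 allS ty andbT.
      by apply: frame_trans fr3 _; apply: frame_set.
    by rewrite /any_time /=; lia.
  - move=> y m o [-> m9 ys fr] _ sy.
    have yE : y = size s by apply/eqP; rewrite eqn_leq ys.
    by split=> //; rewrite m9 yE.
rewrite /=; nia.
Qed.


Lemma size_covectors ks : uniq ks -> {subset ks <= V} -> size ks <= phi.
Proof.
by move=> u sub; rewrite cardE; apply: uniq_leq_size => // x /sub; rewrite mem_enum.
Qed.

(** * Invariants of the loops over cocircuits and covectors *)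

(** The sign cells of the free slot are left unconstrained, as a composition that was already known
    remains there; its pointers are null by [st_out]. *)
Definition state ks mem :=
  [/\ [/\ uniq ks, {subset ks <= V} & sv0 k \in ks], cell mem 0 = size ks,
   forall x i, x < size ks -> i < k -> cell mem (kaddr x i) = vget (key ks x) i &
   exists ptr path, search_tree s ks ptr path /\
     forall x (b : bool), cell mem (paddr x b) = ptr x b].

Lemma state_frame X ks m m' : frame X m m' -> state ks m ->
  all (gtn 16) X -> 0 \notin X -> state ks m'.
Proof.
move=> fr [ksP m0 keys [ptr [path [tree ptrs]]]] X16 X0; split=> //.
- by rewrite fr.
- by move=> x i xs ik; rewrite (frame_kaddr _ _ X16 fr) keys.
by exists ptr, path; split=> // x b; rewrite (frame_paddr _ _ X16 fr).
Qed.

(* The maximum comes first, so that covector number [x] is node [x + 1]. *)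
Definition emitted ks out arcs := exists rs : seq (record k),
  [/\ out = flatten [seq record_code r | r <- rs],
      rec_nodes rs = None :: [seq Some v | v <- ks] & rec_arcs rs = arcs].

Lemma emitted_node ks out arcs w : w != sv0 k -> emitted ks out arcs ->
  emitted (rcons ks w) (out ++ 2 :: sv_code w) arcs.
Proof.
move=> w0 [rs [-> nE aE]]; exists (rcons rs (NodeRec (Some w))); split.
- by rewrite map_rcons flatten_rcons /= (negbTE w0).
- by move: nE; rewrite /rec_nodes -!cats1 pmap_cat map_cat /= => ->.
by move: aE; rewrite /rec_arcs -cats1 pmap_cat /= cats0.
Qed.

Lemma emitted_arc ks out arcs a b : emitted ks out arcs ->
  emitted ks (out ++ [:: 3; a; b]) (rcons arcs (a, b)).
Proof.
move=> [rs [-> nE aE]]; exists (rcons rs (ArcRec a b)); split.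
- by rewrite map_rcons flatten_rcons.
- by move: nE; rewrite /rec_nodes -cats1 pmap_cat /= cats0.
by move: aE; rewrite /rec_arcs -!cats1 pmap_cat /= => ->.
Qed.

Definition first_cover v j :=
  (sv_comp v (coc j) != v) && minimal_at v (sv_comp v (coc j)) j.

Definition target ks v j := (index (sv_comp v (coc j)) ks).+1.

Definition body_time := (size s).+2 * (20 * any_time).

Lemma run_cocircuit_body ks arcs p j mem out :
  state ks mem -> emitted ks out arcs -> cell mem 1 = p -> p < size ks ->
  cell mem 2 = j -> j < size s ->
  let v := key ks p in
  run cocircuit_body mem out body_time (fun m o => exists ks',
    [/\ [/\ prefix ks ks', state ks' m & sv_comp v (coc j) \in ks'],
     emitted ks' o (if first_cover v j then rcons arcs (p.+1, target ks' v j) else arcs) &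
     [/\ cell m 1 = p, cell m 2 = j &
      cell m 10 = if first_cover v j then 1 else cell mem 10]]).
Proof.
move=> st em m1 ps m2 js v.
have [[ks_uniq ksV k0] m0 keys [ptr [path [tree ptrs]]]] := st.
have gt0 := phi_gt0; have gt2 := any_time_ge.
have size_phi := size_covectors ks_uniq ksV.
pose w := sv_comp v (coc j).
have Vv : v \in V by apply/ksV/mem_nth.
have Vw : w \in V.
  apply: (om_comp omV Vv); have := mem_nth (sv0 k) js.
  by rewrite sV inE => /andP[].
have vw : sv_le v w by apply: sv_le_comp.
apply: run_time.
  apply: run_seq; apply: run_weaken; first apply: (run_any_element
    (P := fun x => (vget v x == 0) && (vget (coc j) x != 0))) => //.
    move=> x m xk fr m3.
    have [f1 f2] : cell m 1 = p /\ cell m 2 = j by rewrite !fr.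
    by rewrite !testE eval_cocircuit_at !evalE ?m3 ?f1 ?f2 // (frame_kaddr _ _ _ fr) // keys.
    by [].
  rewrite has_comp_neq => mA oA [-> mA7 frA].
  have stA := state_frame frA st isT isT.
  have [mA1 mA2 mA10] : [/\ cell mA 1 = p, cell mA 2 = j & cell mA 10 = cell mem 10].
    by rewrite !frA.
  have [_ mA0 keysA [ptrA [pathA [treeA ptrsA]]]] := stA.
  apply: run_if; rewrite eval_reg mA7; last first.
    move=> /eqP; rewrite eqb0 negbK => /eqP wv.
    apply: run_skip; exists ks; rewrite /first_cover wv eqxx /=; split=> //.
    by split=> //; [exact: prefix_refl|exact: mem_nth].
  rewrite eqb0 negbK => nwv.
  (* A composition that differs from [v] lies strictly above it and so is nonzero; hence its node
     record has the long form. *)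
  have w0 : w != sv0 k.
    apply: contraNneq nwv => w0; rewrite -/w w0; apply/eqP/sv_le_anti.
      by apply/sv_leP=> i; left; rewrite ffunE.
    by rewrite -w0.
  apply: run_seq; apply: run_weaken; first apply: (run_write_composition (v := v)) => //.
  - by rewrite mA0.
  - by rewrite mA1 mA0 neq_ltn ps.
  - by rewrite mA2.
  - by move=> x xk; rewrite mA1 keysA.
  - by [].
  rewrite mA0 mA2 => mB oB [-> keyB frB].
  have regB r : r != 3 -> r < 16 -> cell mB r = cell mA r.
    by move=> r3 r16; apply: frB => // x xk; rewrite /kaddr; lia.
  have pB x (b : bool) : cell mB (paddr x b) = ptrA x b.
    by rewrite frB ?ptrsA // => i ik; rewrite eq_sym kaddr_paddr.
  have kB x i : x < size ks -> i < k -> cell mB (kaddr x i) = vget (key ks x) i.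
    move=> xs ik; rewrite frB ?keysA // => i' ik'.
    by rewrite /kaddr slot_inj ?(ltn_eqF xs); lia.
  apply: run_seq; apply: run_weaken; first apply: (run_search (w := w) _ treeA ksV ks_uniq Vw) => //.
  - by rewrite size_phi andbT; apply: leq_ltn_trans ps.
  - by rewrite regB.
  - by [].
  move=> mC oC [ks' [ptr' [path' [[-> ks'E mC5] tree' pC frC]]]].
  have regC r : r < 16 -> r \notin search_regs -> cell mC r = cell mA r.
    by move=> r16 rS; rewrite (search_frame_reg frC) // regB //;
      move: rS; rewrite !inE negb_or => /andP[].
  have ks'_uniq : uniq ks'.
    by rewrite ks'E; case: ifP => // wks; rewrite rcons_uniq wks.
  have ks'V : {subset ks' <= V}.
    rewrite ks'E; case: ifP => // _ x; rewrite mem_rcons inE => /predU1P[->|/ksV] //.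
  have wks' : w \in ks'.
    by rewrite ks'E; case: ifP => // _; rewrite mem_rcons mem_head.
  have pks' : prefix ks ks'.
    by rewrite ks'E; case: ifP => _; [exact: prefix_refl|exact: prefix_rcons].
  have size_phi' := size_covectors ks'_uniq ks'V.
  have keysC x i : x < size ks' -> i < k -> cell mC (kaddr x i) = vget (key ks' x) i.
    move=> xs ik; rewrite (search_frame_kaddr _ frC) //.
    move: xs; rewrite ks'E; case: ifP => wks; first by move=> xs; rewrite kB.
    rewrite size_rcons ltnS leq_eqVlt nth_rcons => /predU1P[->|xs].
      by rewrite ltnn eqxx keyB.
    by rewrite xs kB.
  have keyq x : x < k -> cell mC (kaddr (cell mC 5) x) = vget w x.
    by move=> xk; rewrite mC5 keysC ?index_mem // nth_index.
  apply: run_seq; apply: run_weaken; first apply: (run_output_new (ks := ks) (w := w)) => //.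
  - by rewrite -ks'E.
  - by rewrite regC.
  - by rewrite -ks'E.
  - by [].
  rewrite -ks'E => mD oD [-> mD0 frD].
  have [mD1 mD2 mD5 mD10] : [/\ cell mD 1 = p, cell mD 2 = j, cell mD 5 = index w ks' &
      cell mD 10 = cell mem 10].
    by split; rewrite frD // ?mC5 // regC.
  have stD : state ks' mD.
    split=> //.
    - by split=> //; have /prefixP[t ->] := pks'; rewrite mem_cat k0.
    - by move=> x i xs ik; rewrite (frame_kaddr _ _ _ frD) // keysC.
    - by exists ptr', path'; split=> // x b; rewrite (frame_paddr _ _ _ frD).
  have emD : emitted ks' (out ++ (if w \in ks then [::] else 2 :: sv_code w)) arcs.
    by rewrite ks'E; case: ifP => _; [rewrite cats0|apply: emitted_node].
  have keyv x : x < k -> cell mD (kaddr p x) = vget v x.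
    move=> xk; have [_ _ keysD _] := stD.
    have ps' : p < size ks' by apply: leq_trans ps (size_prefix pks').
    rewrite keysD //; congr vget.
    by have /prefixP[t ->] := pks'; rewrite nth_cat ps.
  apply: run_seq; apply: run_weaken; first apply: (run_check_minimal (v := v) (w := w)) => //.
  - by rewrite mD1.
  - by move=> x xk; rewrite (frame_kaddr _ _ _ frD) // mD5 -keyq // mC5.
  - by [].
  rewrite mD2 => mE oE [-> mE9 frE].
  have stE := state_frame frE stD isT isT.
  have [mE1 mE2 mE5 mE10] : [/\ cell mE 1 = p, cell mE 2 = j, cell mE 5 = index w ks' &
      cell mE 10 = cell mem 10].
    by rewrite !frE.
  have fc : first_cover v j = (cell mE 9 != 0).
    by rewrite /first_cover nwv mE9 eqb0 negbK.
  apply: run_if; rewrite eval_reg => m9; last first.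
    by apply: run_skip; exists ks'; rewrite fc m9.
  apply: run_seq; apply: run_seq; apply: run_output; apply: run_seq; apply: run_output.
  apply: run_output; apply: run_set_reg => //; first by rewrite eval_const; lia.
  have frF : frame [:: 10] mE (set_nth 0 mE 10 (eval inp mE (Const 1))) by apply: frame_set.
  exists ks'; rewrite fc m9; split.
  - by split=> //; apply: (state_frame frF).
  - rewrite !evalE mE1 mE5 !addn1 /target -/w.
    by have := emitted_arc p.+1 (index w ks').+1 emD; rewrite -!cats1 -!catA.
  - by rewrite !cell_set /= mE1 mE2.
rewrite /body_time /search_time /=.
have : size s * 200 <= size s * any_time by rewrite leq_mul2l any_time_ge orbT.
have : 100 * k.+1 <= any_time by rewrite leq_mul2r.
nia.
Qed.


Definition targets ks v j := [seq target ks v l | l <- iota 0 j & first_cover v l].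

Definition all_targets ks v :=
  if has (first_cover v) (iota 0 (size s)) then targets ks v (size s) else [:: 0].

Definition arcs_from ks p := [seq (p.+1, t) | t <- all_targets ks (key ks p)].

Lemma key_prefix ks ks' p : prefix ks ks' -> p < size ks -> key ks' p = key ks p.
Proof. by move=> /prefixP[t ->] ps; rewrite nth_cat ps. Qed.

Lemma target_prefix ks ks' v j : prefix ks ks' -> sv_comp v (coc j) \in ks ->
  target ks' v j = target ks v j.
Proof. by move=> /prefixP[t ->] wks; rewrite /target index_cat wks. Qed.

Lemma mem_prefix ks ks' : prefix ks ks' -> {subset ks <= ks'}.
Proof. by move=> /prefixP[t ->] x xks; rewrite mem_cat xks. Qed.

Definition covector_time := size s * (body_time + 100) + 100.

(** The arcs are described through every extension [ks''], because the final list of covectors is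
    not yet known. The compositions involved are already listed, so their positions no longer
    change. *)
Lemma run_covector_body ks arcs p mem out :
  state ks mem -> emitted ks out arcs -> cell mem 1 = p -> p < size ks ->
  run covector_body mem out covector_time (fun m o => exists ks' arcs',
    [/\ [/\ prefix ks ks', state ks' m & cell m 1 = p],
     forall l, l < size s -> sv_comp (key ks p) (coc l) \in ks',
     emitted ks' o arcs' &
     forall ks'', prefix ks' ks'' -> arcs' = arcs ++ arcs_from ks'' p]).
Proof.
move=> st em m1 ps; set v := key ks p.
apply: run_time.
  apply: run_seq; apply: run_set_reg => //; rewrite eval_const.
  have fr0 : frame [:: 10] mem (set_nth 0 mem 10 0) by apply: frame_set.
  set mA := set_nth _ _ _ _ in fr0 *.
  have stA := state_frame fr0 st isT isT.
  have mA1 : cell mA 1 = p by rewrite fr0.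
  have mA10 : cell mA 10 = 0 by rewrite cell_set.
  apply: run_seq; apply: (run_for (M := size s) (t := body_time) (I := fun j m o => exists ks' arcs',
    [/\ [/\ prefix ks ks', state ks' m, cell m 1 = p & cell m 10 = has (first_cover v) (iota 0 j)],
     j <= size s /\ forall l, l < j -> sv_comp v (coc l) \in ks',
     emitted ks' o arcs' &
     forall ks'', prefix ks' ks'' -> arcs' = arcs ++ [seq (p.+1, t) | t <- targets ks'' v j]])).
  - exact: reg_lt_msize.
  - by rewrite lim_reg // addnAC leq_addl.
  - exists ks, arcs; split=> //; last by move=> *; rewrite cats0.
    have frB : frame [:: 2] mA (set_nth 0 mA 2 0) by apply: frame_set.
    split; [exact: prefix_refl|exact: (state_frame frB)|by rewrite frB|by rewrite frB].
  - move=> j m o [ks1 [arcs1 [[pre1 st1 m11 m110] [_ clos1] em1 arcs1E]]] m2 js'.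
    have {js'}js : j < size s := js'.
    have ps1 : p < size ks1 by apply: leq_trans ps (size_prefix pre1).
    have v1 : key ks1 p = v by apply: key_prefix.
    split=> //; apply: run_weaken; first exact: (run_cocircuit_body st1 em1 m11 ps1 m2 js).
      by [].
    move=> m' o'; rewrite v1 => -[ks2 [[pre2 st2 wks2] em2 [m'1 m'2 m'10]]]; split=> //.
    have frB : frame [:: 2] m' (set_nth 0 m' 2 j.+1) by apply: frame_set.
    exists ks2, (if first_cover v j then rcons arcs1 (p.+1, target ks2 v j) else arcs1).
    split=> //.
    + split; [exact: prefix_trans pre1 pre2|exact: (state_frame frB)|by rewrite frB|].
      rewrite frB // m'10 m110 iotaS has_rcons.
      by case: (first_cover v j).
    + split=> // l; rewrite ltnS leq_eqVlt => /predU1P[->//|lj].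
      exact: mem_prefix pre2 _ (clos1 l lj).
    + move=> ks3 pre3; rewrite /targets iotaS filter_rcons.
      rewrite (arcs1E ks3 (prefix_trans pre2 pre3)).
      case: (first_cover v j) => //.
      by rewrite !map_rcons -rcons_cat (target_prefix pre3 wks2).
  - move=> j m o [ks1 [arcs1 [[pre1 st1 m11 m110] [js clos1] em1 arcs1E]]] _ js'.
    have {js' js}jE : j = size s by apply/eqP; rewrite eqn_leq js.
    rewrite {}jE in m110 clos1 arcs1E.
    apply: run_if; rewrite eval_reg m110.
      rewrite eqb0 negbK => hasE; apply: run_skip; exists ks1, arcs1; split=> // ks2 pre2.
      rewrite (arcs1E _ pre2) /arcs_from /all_targets.
      by rewrite (key_prefix (prefix_trans pre1 pre2) ps) hasE.
    move=> /eqP; rewrite eqb0 => hasE.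
    apply: run_seq; apply: run_output; apply: run_seq; apply: run_output; apply: run_output.
    exists ks1, (rcons arcs1 (p.+1, 0)); split=> //.
      rewrite !evalE m11 addn1.
      by have := emitted_arc p.+1 0 em1; rewrite -!cats1 -!catA.
    move=> ks2 pre2; rewrite (arcs1E _ pre2) /arcs_from /all_targets.
    rewrite (key_prefix (prefix_trans pre1 pre2) ps) (negbTE hasE) /targets.
    rewrite -/v; have -> : [seq l <- iota 0 (size s) | first_cover v l] = [::].
      by apply/eqP; rewrite -[_ == _]negbK -has_filter.
    by rewrite /= cats0 cats1.
by rewrite /covector_time /=; lia.
Qed.

Definition all_arcs ks p := flatten [seq arcs_from ks x | x <- iota 0 p].

Definition program_time := phi * (covector_time + 100) + 100.

Lemma run_hasse_program :
  run hasse_program [::] [::] program_time (fun m o => exists ks,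
    [/\ uniq ks, ks =i V & emitted ks o (all_arcs ks (size ks))]).
Proof.
have gt0 := phi_gt0.
apply: run_time.
  apply: run_seq; apply: run_output; apply: run_seq; apply: run_output.
  apply: run_seq; apply: run_set_reg => //; first by rewrite eval_const; lia.
  rewrite !eval_const; set mA := set_nth _ _ _ _.
  have mA0 : cell mA 0 = 1 by rewrite cell_set.
  have mAE a : 0 < a -> cell mA a = 0 by case: a => // a _; rewrite cell_set /= nth_nil.
  have stA : state [:: sv0 k] mA.
    split=> //.
    - split=> //; last exact: mem_head.
      by move=> x; rewrite inE => /eqP->; apply: om_zero omV.
    - by move=> [|x] // i _ ik; rewrite vget0 mAE.
    exists (fun _ _ => 0), (fun=> [::]); split=> [|x b]; first exact: search_tree1.
    by rewrite mAE.
  (* The processed covectors have all their compositions in the list. When the queue is exhausted,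
     the list is closed under composition with cocircuits and thus contains [V]. *)
  apply: (run_for (M := phi) (t := covector_time) (I := fun p m o => exists ks arcs,
    [/\ state ks m, p <= size ks,
     forall x l, x < p -> l < size s -> sv_comp (key ks x) (coc l) \in ks,
     emitted ks o arcs &
     forall ks', prefix ks ks' -> arcs = all_arcs ks' p])).
  - exact: reg_lt_msize.
  - by rewrite lim_reg // -addnA leq_addr.
  - have frB : frame [:: 1] mA (set_nth 0 mA 1 0) by apply: frame_set.
    have stB := state_frame frB stA isT isT.
    exists [:: sv0 k], [::]; split=> //.
    exists [:: NodeRec None; NodeRec (Some (sv0 k))]; split=> //=.
    by rewrite eqxx.
  - move=> p m o [ks [arcs [st _ clos em arcsE]]] m1 pks'.
    have [[ks_uniq ksV k0] m0 keys _] := st.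
    have {pks'}pks : p < size ks by rewrite -m0.
    have size_phi := size_covectors ks_uniq ksV.
    split; first exact: leq_trans pks size_phi.
    apply: run_weaken; first exact: (run_covector_body st em m1 pks).
      by [].
    move=> m' o' [ks1 [arcs1 [[pre1 st1 m'1] clos1 em1 arcs1E]]]; split=> //.
    have frB : frame [:: 1] m' (set_nth 0 m' 1 p.+1) by apply: frame_set.
    exists ks1, arcs1; split=> //.
    + exact: (state_frame frB).
    + exact: leq_trans pks (size_prefix pre1).
    + move=> x l; rewrite ltnS leq_eqVlt => /predU1P[->|xp] ls.
        by rewrite (key_prefix pre1 pks) clos1.
      have xks := ltn_trans xp pks.
      by rewrite (key_prefix pre1 xks) (mem_prefix pre1) // clos.
    + move=> ks2 pre2; rewrite (arcs1E _ pre2) (arcsE _ (prefix_trans pre1 pre2)).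
      by rewrite /all_arcs iotaS map_rcons flatten_rcons.
  - move=> p m o [ks [arcs [st pks clos em arcsE]]] m1 pks'.
    have [[ks_uniq ksV k0] m0 keys _] := st.
    have pE : p = size ks by apply/eqP; rewrite eqn_leq pks -m0.
    exists ks; split=> //; last by rewrite -pE -(arcsE ks (prefix_refl _)).
    move=> z; apply/idP/idP; first exact: ksV.
    apply: (closed_contains_all omV sV k0) => v c.
    move=> /(nthP (sv0 k))[x xs <-] /(nthP (sv0 k))[l ls <-].
    by apply: clos; rewrite ?pE.
by rewrite /program_time /=; lia.
Qed.

End Correctness.

(** * The Hasse diagram *)

Section HasseDiagram.
Variables (k : nat) (V : {set signvec k}) (s : seq (signvec k)).
Hypothesis omV : is_oriented_matroid V.
Hypothesis sV : s =i cocircuits V.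
Variable ks : seq (signvec k).
Hypothesis ks_uniq : uniq ks.
Hypothesis ksV : ks =i V.
Implicit Types v w : signvec k.

Local Notation key ks x := (nth (sv0 k) ks x).
Local Notation coc j := (nth (sv0 k) s j).

Lemma comp_mem v j : v \in V -> j < size s -> sv_comp v (coc j) \in ks.
Proof.
move=> Vv js; rewrite ksV; apply: (om_comp omV Vv).
by have := mem_nth (sv0 k) js; rewrite sV inE => /andP[].
Qed.

(* Choose a smallest support, then the smallest index. *)
Lemma first_cover_exists v j : j < size s -> sv_comp v (coc j) != v ->
  has (first_cover s v) (iota 0 (size s)).
Proof.
(* [F] encodes the lexicographic order of support size and index in one number, as every index is
   less than the factor [(size s).+1]. *)
move=> js nj; pose F (i : 'I_(size s)) := #|supp (sv_comp v (coc i))| * (size s).+1 + i.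
case: (@arg_minnP _ (Ordinal js) (fun i => sv_comp v (coc i) != v) F nj) => i ni iP.
apply/hasP; exists (val i); first by rewrite mem_iota /=.
rewrite /first_cover ni; apply/allP => l; rewrite mem_iota /= => ls.
apply/negP=> /and3P[nl le].
have := iP (Ordinal ls) nl; rewrite /F /= => Fle.
case: eqVneq Fle => [-> |nw] /=; first by rewrite leq_add2l ltnNge => ->.
have := supp_lt le nw; rewrite -(leq_pmul2r (ltn0Sn (size s))) mulSn.
move: (#|_| * _) (#|_| * _) => A B AB BA _; lia.
Qed.

Lemma first_cover_same v w :
  (exists2 l, l < size s & first_cover s v l && (sv_comp v (coc l) == w)) <->
  has (fun c => [&& w == sv_comp v c, w != v &
     all (fun c' => ~~ [&& sv_comp v c' != v, sv_le (sv_comp v c') w &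
                           sv_comp v c' != w]) s]) s.
Proof.
split=> [[l ls /andP[/andP[nv mn] /eqP wE]]|/hasP[c cs /and3P[/eqP wE nv /allP mn]]].
  apply/hasP; exists (coc l); first exact: mem_nth.
  rewrite -wE eqxx nv; apply/allP => _ /(nthP (sv0 k))[i iS <-].
  have /(allP mn) : i \in iota 0 (size s) by rewrite mem_iota.
  by apply: contra => /and3P[-> ->] ->.
pose l := find (fun c => sv_comp v c == w) s.
have hl : has (fun c => sv_comp v c == w) s by apply/hasP; exists c; rewrite ?wE.
have lw : sv_comp v (coc l) = w by apply/eqP/(nth_find (sv0 k) hl).
exists l; rewrite -?has_find // /first_cover lw nv eqxx andbT.
apply/allP => i; rewrite mem_iota /= => iS; apply/negP => /and3P[ni le].
case: eqVneq => [iw /= il|nw _].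
  by have := before_find (sv0 k) il; rewrite iw eqxx.
by have /negP[] := mn _ (mem_nth (sv0 k) iS); rewrite ni le.
Qed.

Lemma mem_all_targets v q : v \in V -> q < (size ks).+1 ->
  (q \in all_targets s ks v) =
  face_covered V (Some v) (nth None (None :: [seq Some w | w <- ks]) q).
Proof.
move=> Vv; case: q => [|q] qs /=.
  rewrite (cocircuits_top omV sV Vv) /all_targets; case: ifPn => H.
    have -> : 0 \in targets s ks v (size s) = false by apply/negP => /mapP[].
    apply/esym/negP => /allP A; move/hasP: H => [l]; rewrite mem_iota /= => ls.
    by rewrite /first_cover (A _ (mem_nth _ ls)).
  apply/esym/allP => _ /(nthP (sv0 k))[i iS <-]; apply: contraNT H => H.
  exact: first_cover_exists H.
rewrite (nth_map (sv0 k)) // (cocircuits_cover omV sV) // -?ksV ?mem_nth //.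
apply/idP/idP => [|/first_cover_same[l ls /andP[fc /eqP wE]]].
  rewrite /all_targets; case: ifP => // _ /mapP[l].
  rewrite mem_filter mem_iota /= => /andP[fc ls] [->].
  apply/first_cover_same; exists l => //.
  by rewrite nth_index ?fc ?eqxx // comp_mem.
have H : has (first_cover s v) (iota 0 (size s)).
  by apply/hasP; exists l; rewrite ?mem_iota.
rewrite /all_targets H; apply/mapP; exists l; first by rewrite mem_filter fc mem_iota.
by rewrite /target wE index_uniq.
Qed.

Lemma all_targets_leq v q : v \in V -> q \in all_targets s ks v -> q < (size ks).+1.
Proof.
move=> Vv; rewrite /all_targets; case: ifP => _; last by rewrite inE => /eqP->.
move=> /mapP[l]; rewrite mem_filter mem_iota /= => /andP[_ ls] ->.
by rewrite /target ltnS index_mem comp_mem.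
Qed.

(** Of two indices with the same composition, the larger one fails the tie-break. *)
Lemma all_targets_uniq v : v \in V -> uniq (all_targets s ks v).
Proof.
move=> Vv; rewrite /all_targets; case: ifP => // _.
rewrite map_inj_in_uniq ?filter_uniq ?iota_uniq // => l l'.
rewrite !mem_filter !mem_iota /= => /andP[fl ls] /andP[fl' ls'] [E].
have {}E : sv_comp v (coc l) = sv_comp v (coc l').
  by rewrite -(nth_index (sv0 k) (comp_mem Vv ls)) E nth_index // comp_mem.
have no i j : i < size s -> first_cover s v j -> sv_comp v (coc i) = sv_comp v (coc j) -> ~ i < j.
  move=> iS /andP[nv /allP/(_ i)]; rewrite mem_iota => /(_ iS) H E' ij.
  by move: H; rewrite E' nv sv_le_refl ij orbT.
by have := no _ _ ls fl' E; have := no _ _ ls' fl (esym E); lia.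
Qed.

Lemma all_arcsP a b p : reflect
  (exists x, [/\ x < p, a = x.+1 & b \in all_targets s ks (key ks x)])
  ((a, b) \in all_arcs s ks p).
Proof.
apply: (iffP flatten_mapP) => [[x]|[x [xp -> bx]]].
  by rewrite mem_iota /= => xp /mapP[t tx [-> ->]]; exists x.
by exists x; rewrite ?mem_iota //; apply/mapP; exists b.
Qed.

Lemma all_arcs_uniq p : p <= size ks -> uniq (all_arcs s ks p).
Proof.
elim: p => // p IH ps; rewrite /all_arcs iotaS map_rcons flatten_rcons cat_uniq.
rewrite [uniq _]IH ?(ltnW ps) //=; apply/andP; split.
  apply/hasPn => _ /mapP[t _ ->]; apply/negP => /all_arcsP[x [xp [E] _]].
  by rewrite E ltnn in xp.
rewrite map_inj_uniq; last by move=> x y [].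
by rewrite all_targets_uniq // -ksV mem_nth.
Qed.

Lemma hasse_diagram :
  is_hasse_diagram V (None :: [seq Some v | v <- ks]) (all_arcs s ks (size ks)).
Proof.
split.
- rewrite /= map_inj_uniq ?ks_uniq ?andbT; last by move=> x y [].
  by apply/negP => /mapP[].
- move=> [v|]; rewrite !inE //= mem_map; last by move=> x y [].
  by rewrite mem_imset ?ksV //; move=> x y [].
- exact: all_arcs_uniq.
- move=> i j; rewrite /= size_map; apply/all_arcsP/and3P => [[x [xs -> jx]]|].
    have Vx : key ks x \in V by rewrite -ksV mem_nth.
    have js := all_targets_leq Vx jx.
    by split=> //=; rewrite (nth_map (sv0 k)) // -mem_all_targets.
  (* Node 0 is the maximum, which nothing covers. *)
  case: i => [|x] [xs js]; first case/and4P=> _ _.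
    by case: (nth None _ j) => [v|] /andP[].
  rewrite /= (nth_map (sv0 k)) // => cov; exists x; split=> //.
  by rewrite mem_all_targets // -ksV mem_nth.
Qed.

End HasseDiagram.

(** * Time and space in terms of the numbers of cocircuits, elements and covectors *)

Section Bounds.
Variables (k : nat) (V : {set signvec k}) (s : seq (signvec k)).
Hypothesis omV : is_oriented_matroid V.
Hypothesis sV : s =i cocircuits V.
Hypothesis s_uniq : uniq s.

Lemma size_cocircuits : size s = #|cocircuits V|.
Proof. by rewrite -(card_uniqP s_uniq); apply: eq_card. Qed.

Lemma size_cocircuits_leq : size s <= #|V|.
Proof.
rewrite size_cocircuits; apply: subset_leq_card.
by apply/subsetP => v; rewrite inE => /andP[].
Qed.

(** Used in contrapositive form: a cocircuit forces [k > 0], so that [k.+1] is at most [2 * k]. *)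
Lemma no_cocircuits0 : k = 0 -> size s = 0.
Proof.
move=> k0; rewrite size_cocircuits; apply: eq_card0 => v; rewrite inE.
suff -> : v = sv0 k by rewrite eqxx andbF.
by apply/ffunP => -[i ik]; exfalso; move: ik; rewrite k0.
Qed.

Lemma program_time_bound :
  program_time V s <= 400 * 400 * maxn 1 (#|cocircuits V| ^ 2 * k * #|V|).
Proof.
rewrite -size_cocircuits /program_time /covector_time /body_time /any_time.
have [s0|s0] := posnP (size s).
  have -> : #|V| = 1 by apply: (no_cocircuits omV); rewrite -size_cocircuits.
  by rewrite s0; lia.
have k0 : 0 < k by rewrite lt0n; apply: contraTneq s0 => /no_cocircuits0->.
have V0 := phi_gt0 omV.
apply: leq_trans (leq_mul (leqnn _) (leq_maxr _ _)).
set n := size s in s0 *; set f := #|V| in V0 *.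
(* From [n.+2 <= 3 * n] and [k.+1 <= 2 * k] the product is at most 20 * 200 * 6 = 24000 times
   [n * k]; the summand 100 gives 24100. *)
have B : n.+2 * (20 * (200 * k.+1)) + 100 <= 241 * 100 * (n * k).
  have nk : 0 < n * k by rewrite muln_gt0 s0.
  have B : n.+2 * k.+1 <= 6 * (n * k) by nia.
  lia.
have C : n * (n.+2 * (20 * (200 * k.+1)) + 100) + 200 <= 243 * 100 * (n ^ 2 * k).
  have nk : 0 < n ^ 2 * k by rewrite muln_gt0 expn_gt0 s0.
  by have := leq_mul (leqnn n) B; nia.
have := leq_mul (leqnn f) C; nia.
Qed.

Lemma bitlen_leqS x : bitlen x <= x.+1.
Proof.
rewrite ltnS; have [->|x0] := posnP x; first by [].
apply: leq_trans (ltnW (ltn_expl _ (ltnSn 1))) _.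
by have /andP[] := trunc_log_bounds (ltnSn 1) x0.
Qed.

(** Three signs fit into two bits: [3 ^ k] is at most [2 ^ (2 * k)]. *)
Lemma bitlen_covectors : bitlen #|V| <= (2 * k).+1.
Proof.
rewrite ltnS -[leqRHS](@trunc_expnK 2) //; apply: leq_trunc_log.
apply: leq_trans (card_covectors V) _.
by rewrite expnM; case: (k) => // n; rewrite leq_exp2r.
Qed.

Lemma space_slots m :
  \sum_(i < 16 + m * (k + 2)) bitlen (lim V s i) =
  16 * bitlen (#|V| + size s + k) + m * (2 * bitlen #|V| + k * bitlen 2).
Proof.
rewrite -(big_mkord xpredT (fun i => bitlen (lim V s i))).
elim: m => [|m IH].
  rewrite !mul0n !addn0 (eq_big_nat _ _ (F2 := fun=> bitlen (#|V| + size s + k))).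
    by rewrite sum_nat_const_nat.
  by move=> i /andP[_ i16]; rewrite lim_reg.
rewrite (big_cat_nat (n := 16 + m * (k + 2))) ?leq_add2l ?leq_mul2r ?leqnSn ?orbT //=.
rewrite IH -{1}[16 + m * _]add0n big_addn.
have -> : 16 + m.+1 * (k + 2) - (16 + m * (k + 2)) = k.+2 by rewrite mulSn; lia.
rewrite addn2 big_nat_recl // big_nat_recl //.
have E0 : 0 + (16 + m * k.+2) = paddr k m false by rewrite /paddr addn2; lia.
have E1 : 1 + (16 + m * k.+2) = paddr k m true by rewrite /paddr addn2; lia.
rewrite E0 E1 !lim_paddr.
rewrite (eq_big_nat _ _ (F2 := fun=> bitlen 2)); last first.
  move=> i /andP[_ ik]; have -> : i.+2 + (16 + m * k.+2) = kaddr k m i by rewrite /kaddr addn2; lia.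
  by rewrite lim_kaddr.
rewrite sum_nat_const_nat subn0 [m.+1 * _]mulSn.
move: (k * bitlen 2) (bitlen #|V|) => b c; move: (m * _) => a; move: (16 * _) => d; lia.
Qed.

(** For the sixteen registers the crude estimate [bitlen x <= x.+1] suffices, since there are at
    most as many cocircuits as covectors. The pointers recur in every slot and need the bound
    logarithmic in the number of covectors. *)
Lemma space_bound :
  space_limit (msize V) (lim V s) <= 400 * 400 * maxn 1 (#|V| * k).
Proof.
rewrite /space_limit /msize space_slots.
have := bitlen_leqS (#|V| + size s + k); have := bitlen_covectors.
have -> : bitlen 2 = 2 by [].
have := card_covectors V; have := phi_gt0 omV; have := size_cocircuits_leq.
move: #|V| (size s) => f n; move: (bitlen f) (bitlen (f + n + k)) => b B nf f0 f3 bk Bk.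
have [k0|k0] := posnP k; first by rewrite k0 expn0 in f3 bk Bk *; nia.
apply: leq_trans (leq_mul (leqnn _) (leq_maxr _ _)).
have H : (f + 1) * (2 * b + k * 2) <= 2 * f * (8 * k) by apply: leq_mul; lia.
nia.
Qed.

End Bounds.

Theorem mainTheorem5 :
  exists (p : com) (C : nat),
    forall (k : nat) (V : {set signvec k}) (s : seq (signvec k)),
      is_oriented_matroid V -> uniq s -> s =i cocircuits V ->
      exists (t b : nat) (mem out : seq nat),
        [/\ exec (input_code s) p [::] [::] t b mem out,
            encodes_hasse_diagram V out,
            t <= C * maxn 1 (#|cocircuits V| ^ 2 * k * #|V|) &
            b <= C * maxn 1 (#|V| * k)].
Proof.
exists hasse_program, (400 * 400) => k V s omV s_uniq sV.
have [|t [b [mem [out [ex tle ble _ [ks [ks_uniq ksV [rs [outE nE aE]]]]]]]]] :=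
  run_hasse_program omV sV.
  by split=> // i; rewrite nth_nil.
exists t, b, mem, out; split=> //.
- by exists rs; rewrite nE aE; split=> //; apply: hasse_diagram.
- exact: leq_trans tle (program_time_bound omV sV s_uniq).
- exact: leq_trans ble (space_bound omV sV s_uniq).
Qed.
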